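(* Consider the plant $\dot x(t)=f(x(t),u(t),w(t))$, a fixed integer $\ell\ge 1$, a family of approximate discrete-time plant models $F^a_{T,h}$, and a family of control laws $u_{T,h}$, with the associated exact plant model $F^e_T$, single-rate approximate closed-loop family $x(k+1)=\mathcal{F}^a_{T,h}(x(k),w_T[k])$ and dual-rate exact closed-loop family $x(k+1)=\mathcal{F}^e_{T,h}(x(k),w_T[k])$, all as defined in the context. Assume that: (i) the family of single-rate approximate discrete-time models $x(k+1)=\mathcal{F}^a_{T,h}(x(k),w_T[k])$ is Lyapunov semiglobally practically integral input-to-integral-state stable (Lyapunov-SP-iIiSS); (ii) $F^a_{T,h}$ is one-step consistent with $F^e_T$; (iii) $u_{T,h}$ is uniformly locally Lipschitz. Then the family of dual-rate exact discrete-time models $x(k+1)=\mathcal{F}^e_{T,h}(x(k),w_T[k])$ is semiglobally practically integral-input-to-integral-state stable (SP-iIiSS).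
   Context: **Notation.** $|\cdot|$ is the Euclidean norm. A function $\rho:\mathbb{R}_{\ge 0}\to\mathbb{R}_{\ge 0}$ is positive definite if it is continuous, zero at zero and positive elsewhere. $\alpha\in\mathcal{K}$ if $\alpha$ is positive definite and strictly increasing; $\alpha\in\mathcal{K}_\infty$ if in addition $\alpha(s)\to+\infty$ as $s\to+\infty$. For $w:\mathbb{R}_{\ge 0}\to\mathbb{R}^p$, $T>0$ and $k\in\mathbb{Z}_{\ge 0}$, $w_T[k]$ is the restriction of $w$ to $[kT,(k+1)T]$ (written $w_T$ when $k$ is not emphasized), and $|w_T|_\infty$ denotes the supremum norm of this restriction. For measurable $w$ and $\gamma\in\mathcal{K}$, $|w|_\gamma:=\int_0^{+\infty}\gamma(|w(s)|)\,ds$ and $|w|_\infty:=\sup_{t\ge0}|w(t)|$. $\mathcal{L}_\infty$ is the set of measurable $w$ with $|w|_\infty<+\infty$; $w\in\mathcal{L}_\gamma(r)$ means $|w|_\gamma<r$, and $w\in\mathcal{L}_\infty(r)$ means $|w|_\infty<r$. **Plant and sampling.** The plant is $\dot x(t)=f(x(t),u(t),w(t))$ with $x(t)\in\mathbb{R}^n$, $u(t)\in\mathbb{R}^m$, $w(t)\in\mathbb{R}^p$, where $f$ is locally Lipschitz, $f(0,0,0)=0$, and the disturbance $w$ is measurable and locally essentially bounded. The control is held constant on intervals of length $T>0$ (zero-order-hold period): $u(t)=u(kT)=:u(k)$ for $t\in[kT,(k+1)T)$, $k\in\mathbb{Z}_{\ge0}$; write $x(k):=x(kT)$. The state is measured with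 period $T_s=\ell T$, $\ell\ge1$ an integer. **Exact plant model.** $F^e_T(x(k),u(k),w_T[k]):=x(k)+\int_{kT}^{(k+1)T}f(x(\tau),u(k),w(\tau))\,d\tau$, where $x(\cdot)$ is the plant solution on $[kT,(k+1)T]$ from $x(kT)=x(k)$. **Approximate plant model.** A family of maps $x(k+1)=F^a_{T,h}(x(k),u(k),w_T[k])$, where $h$ is a parameter of the numerical integration. **Control laws and dual-rate controller.** $u_{T,h}:\mathbb{R}^n\to\mathbb{R}^m$ with $u_{T,h}(0)=0$. The dual-rate controller is $u(k)=u_{T,h}(x_c(k))$, where $x_c(k)=x(k)$ if $k=i\ell$ for some $i\in\mathbb{Z}_{\ge0}$, and $x_c(k)=F^a_{T,h}(x_c(k-1),u(k-1),0)$ otherwise (the disturbance argument being set to zero). The single-rate controller ($\ell=1$) is $u(k)=u_{T,h}(x(k))$. **Closed loops.** The single-rate approximate closed loop is $x(k+1)=\mathcal{F}^a_{T,h}(x(k),w_T[k]):=F^a_{T,h}(x(k),u_{T,h}(x(k)),w_T[k])$. The dual-rate exact closed loop, denoted $x(k+1)=\mathcal{F}^e_{T,h}(x(k),w_T[k])$, is $x(k+1)=F^e_T(x(k),u_{T,h}(x_c(k)),w_T[k])$ with $x_c$ given by the dual-rate rule above (the dependence on $x_c(k)$ is suppressed in the notation). **One-step consistency.** $F^a_{T,h}$ is one-step consistent with $F^e_T$ if for any real numbers $(\Delta_x,\Delta_u,\Delta_w)$ there exist $\rho\in\mathcal{K}_\infty$ and $T^*>0$ such that for each fixed $T\in(0,T^*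 )$ there exists $h^*\in(0,T]$ such that $|F^e_T(x,u,w_T)-F^a_{T,h}(x,u,w_T)|\le T\rho(h)$ for all $x\in\mathbb{R}^n$, $u\in\mathbb{R}^m$, $w\in\mathcal{L}_\infty$ with $|x|\le\Delta_x$, $|u|\le\Delta_u$, $|w_T|_\infty\le\Delta_w$ and all $h\in(0,h^* )$. **Uniformly locally Lipschitz.** $u_{T,h}$ is uniformly locally Lipschitz if for any $\Delta_x>0$ there exist positive reals $T^*$ and $\tilde L$ such that for each fixed $T\in(0,T^* )$ there exists $h^*\in(0,T]$ such that $|u_{T,h}(x_2)-u_{T,h}(x_1)|\le\tilde L|x_2-x_1|$ for all $h\in(0,h^* )$ and all $x_1,x_2\in\mathbb{R}^n$ with $\max\{|x_1|,|x_2|\}\le\Delta_x$. **Lyapunov-SP-iIiSS.** The family $x(k+1)=\mathcal{F}^a_{T,h}(x(k),w_T[k])$ is Lyapunov-SP-iIiSS if there exist $\underline\alpha,\overline\alpha\in\mathcal{K}_\infty$, $\alpha\in\mathcal{K}_\infty$ and $\hat\gamma\in\mathcal{K}$ such that: for any positive reals $(\Delta_1,\Delta_2,\Delta_3,\delta_1)$ there exist $T^*>0$ and $M>0$ such that for any fixed $T\in(0,T^* )$ there exists $h^*\in(0,T]$ such that for all $h\in(0,h^* )$ there exists a continuous function $V_{T,h}:\mathbb{R}^n\to\mathbb{R}_{\ge0}$ such that for all $x\in\mathbb{R}^n$ with $|x|\le\Delta_1$ and all $w\in\mathcal{L}_\infty(\Delta_2)\cap\mathcal{L}_{\hat\gamma}(\Delta_3)$,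 $$\underline\alpha(|x|)\le V_{T,h}(x)\le\overline\alpha(|x|),$$ $$V_{T,h}(\mathcal{F}^a_{T,h}(x,w_T))-V_{T,h}(x)\le T\Big[-\alpha(|x|)+\frac1T\int_{kT}^{(k+1)T}\hat\gamma(|w(s)|)\,ds+\delta_1\Big]$$ (with $w_T=w_T[k]$, for every $k\in\mathbb{Z}_{\ge0}$); and moreover $|V_{T,h}(x_1)-V_{T,h}(x_2)|\le M|x_1-x_2|$ for all $x_1,x_2\in\mathbb{R}^n$ with $\max\{|x_1|,|x_2|\}\le\Delta_1$, all $T\in(0,T^* )$ and all $h\in(0,h^* )$. **SP-iIiSS.** The family $x(k+1)=\mathcal{F}^e_{T,h}(x(k),w_T[k])$ is SP-iIiSS if there exist $\alpha,\chi\in\mathcal{K}_\infty$ and $\gamma\in\mathcal{K}$ such that for any positive reals $(\Delta_x,\Delta_w,\delta)$ there exists $T^*>0$ such that for each $T\in(0,T^* )$ there exists $h^*\in(0,T]$ such that for all $w\in\mathcal{L}_\infty(\Delta_w)$, all $x(0)\in\mathbb{R}^n$ with $|x(0)|\le\Delta_x$ and all $h\in(0,h^* )$, each solution of the family exists and satisfies $$T\sum_{i=0}^{k-1}\alpha(|x(i)|)\le\chi(|x(0)|)+\int_0^{kT}\gamma(|w(s)|)\,ds+Tk\delta\qquad\text{for all }k\in\mathbb{Z}_{\ge0}.$$ *)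

(* Defs.v *)
From HB Require Import structures.
From mathcomp Require Import all_boot all_order all_algebra.
From mathcomp Require Import all_classical all_reals all_analysis.

Set Implicit Arguments.
Unset Strict Implicit.
Unset Printing Implicit Defensive.

Import Order.TTheory GRing.Theory Num.Theory.
Import numFieldNormedType.Exports.

Local Open Scope classical_set_scope.
Local Open Scope ring_scope.

(* The library norm on 'rV[R]_n is the max norm, hence a separate Euclidean
   norm. *)
Definition enorm (R : realType) (n : nat) (x : 'rV[R]_n) : R :=
  Num.sqrt (\sum_(i < n) x 0 i ^+ 2).

Definition nonneg_reals (R : realType) : set R := `[0, +oo[.
Arguments nonneg_reals {R}.

(** * Comparison functions *)

(* Functions R_{>=0} -> R_{>=0} are represented by functions R -> R of which
   only the values on [0, +oo[ matter. *)
Definition positive_definite (R : realType) (a : R -> R) : Prop :=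
  [/\ {within nonneg_reals, continuous a}, a 0 = 0 &
      forall s, 0 < s -> 0 < a s].

Definition classK (R : realType) (a : R -> R) : Prop :=
  positive_definite a /\ (forall s t, 0 <= s -> s < t -> a s < a t).

Definition classKoo (R : realType) (a : R -> R) : Prop :=
  classK a /\ a s @[s --> +oo] --> +oo.

(** * Disturbances *)

(* R with the Lebesgue (not only Borel) measurable sets; plain R carries the
   Borel sets. *)
Definition lebesgueType (R : realType) :
    measurableType (((@wlength R idfun)^*)%mu.-cara)%mdisp :=
  caratheodory_type ((@wlength R idfun)^*)%mu.

Notation leb := (@completed_lebesgue_measure _).

(* A disturbance w : R_{>=0} -> R^p is a function on R of which only the values
   on [0, +oo[ matter. *)
Definition Lmeasurable (R : realType) (p : nat) (w : R -> 'rV[R]_p) : Prop :=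
  forall i : 'I_p,
    @measurable_fun _ _ (lebesgueType R) (measurableTypeR R) nonneg_reals
      (fun t => w t 0 i).

Definition supnorm (R : realType) (p : nat) (D : set R) (w : R -> 'rV[R]_p) :
  \bar R := ereal_sup [set (enorm (w t))%:E | t in D].

Definition gnorm (R : realType) (p : nat) (g : R -> R) (w : R -> 'rV[R]_p) :
  \bar R := (\int[leb]_(s in nonneg_reals) (g (enorm (w s)))%:E)%E.

Definition Linfty (R : realType) (p : nat) (w : R -> 'rV[R]_p) : Prop :=
  Lmeasurable w /\ (supnorm nonneg_reals w < +oo)%E.

Definition Linfty_lt (R : realType) (p : nat) (r : R) (w : R -> 'rV[R]_p) :
  Prop := Lmeasurable w /\ (supnorm nonneg_reals w < r%:E)%E.

Definition Lgamma_lt (R : realType) (p : nat) (g : R -> R) (r : R)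
  (w : R -> 'rV[R]_p) : Prop := Lmeasurable w /\ (gnorm g w < r%:E)%E.

Definition sampling_interval (R : realType) (T : R) (k : nat) : set R :=
  `[k%:R * T, k.+1%:R * T].

(* A function with domain [kT, (k+1)T] is represented by the index k, which
   records the domain, and its extension by 0 outside that domain.  Thus a map
   defined on segments depends on w only through its values on [kT, (k+1)T]. *)
Definition segment (R : realType) (p : nat) : Type := (nat * (R -> 'rV[R]_p))%type.

Definition wseg (R : realType) (p : nat) (w : R -> 'rV[R]_p) (T : R) (k : nat) :
  segment R p := (k, patch (fun=> 0) (sampling_interval T k) w).

(** * Plant and discrete-time models *)

Definition locally_lipschitz (R : realType) (n m p : nat)
    (f : 'rV[R]_n -> 'rV[R]_m -> 'rV[R]_p -> 'rV[R]_n) : Prop :=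
  forall (x0 : 'rV[R]_n) (u0 : 'rV[R]_m) (w0 : 'rV[R]_p),
  exists r L : R, 0 < r /\
    forall x1 x2 u1 u2 w1 w2,
      enorm (x1 - x0) < r -> enorm (x2 - x0) < r ->
      enorm (u1 - u0) < r -> enorm (u2 - u0) < r ->
      enorm (w1 - w0) < r -> enorm (w2 - w0) < r ->
      enorm (f x1 u1 w1 - f x2 u2 w2) <=
        L * (enorm (x1 - x2) + enorm (u1 - u2) + enorm (w1 - w2)).

(* Componentwise Lebesgue integral. *)
Definition vintegral (R : realType) (n : nat) (D : set R) (g : R -> 'rV[R]_n) :
  'rV[R]_n := \row_(i < n) \int[leb]_(s in D) (g s 0 i).

(* Caratheodory solutions: phi is absolutely continuous on [a, b], phi(a) = x
   and phi' = f(phi, u, w) almost everywhere, in integral form. *)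
Definition plant_solution (R : realType) (n m p : nat)
    (f : 'rV[R]_n -> 'rV[R]_m -> 'rV[R]_p -> 'rV[R]_n)
    (a b : R) (x : 'rV[R]_n) (u : 'rV[R]_m) (w : R -> 'rV[R]_p)
    (phi : R -> 'rV[R]_n) : Prop :=
  (forall i : 'I_n, leb.-integrable `[a, b]
     (fun s => (f (phi s) u (w s) 0 i)%:E)) /\
  (forall t, a <= t <= b ->
     phi t = x + vintegral `[a, t] (fun s => f (phi s) u (w s))).

(* The graph of the partial map F^e_T: [exact_model f T x u v y] means that
   F^e_T(x, u, v) is defined and equal to y. *)
Definition exact_model (R : realType) (n m p : nat)
    (f : 'rV[R]_n -> 'rV[R]_m -> 'rV[R]_p -> 'rV[R]_n)
    (T : R) (x : 'rV[R]_n) (u : 'rV[R]_m) (v : segment R p) (y : 'rV[R]_n) :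
  Prop :=
  exists2 phi : R -> 'rV[R]_n,
    plant_solution f (v.1%:R * T) (v.1.+1%:R * T) x u v.2 phi &
    y = x + vintegral (sampling_interval T v.1) (fun s => f (phi s) u (v.2 s)).

Definition approx_model (R : realType) (n m p : nat) : Type :=
  R -> R -> 'rV[R]_n -> 'rV[R]_m -> segment R p -> 'rV[R]_n.

Definition control_family (R : realType) (n m : nat) : Type :=
  R -> R -> 'rV[R]_n -> 'rV[R]_m.

Definition single_rate_approx (R : realType) (n m p : nat)
    (Fa : approx_model R n m p) (uc : control_family R n m)
    (T h : R) (x : 'rV[R]_n) (v : segment R p) : 'rV[R]_n :=
  Fa T h x (uc T h x) v.

Fixpoint controller_state (R : realType) (n m p : nat)
    (Fa : approx_model R n m p) (uc : control_family R n m) (l : nat)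
    (T h : R) (x : nat -> 'rV[R]_n) (k : nat) {struct k} : 'rV[R]_n :=
  if (l %| k)%N then x k
  else if k is j.+1 then
    let xc := controller_state Fa uc l T h x j in
    Fa T h xc (uc T h xc) (wseg (fun=> 0) T j)
  else x k.

Definition dual_rate_exact (R : realType) (n m p : nat)
    (f : 'rV[R]_n -> 'rV[R]_m -> 'rV[R]_p -> 'rV[R]_n)
    (Fa : approx_model R n m p) (uc : control_family R n m) (l : nat)
    (T h : R) (w : R -> 'rV[R]_p) (x : nat -> 'rV[R]_n) : Prop :=
  forall k : nat,
    exact_model f T (x k) (uc T h (controller_state Fa uc l T h x k))
      (wseg w T k) (x k.+1).

(** * Assumptions and stability notions *)

(* The bound is required of every value of F^e_T; that F^e_T is defined is not
   part of the assumption. *)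
Definition one_step_consistent (R : realType) (n m p : nat)
    (f : 'rV[R]_n -> 'rV[R]_m -> 'rV[R]_p -> 'rV[R]_n)
    (Fa : approx_model R n m p) : Prop :=
  forall Dx Du Dw : R,
  exists (rho : R -> R) (Tstar : R), classKoo rho /\ 0 < Tstar /\
  forall T, 0 < T < Tstar ->
  exists hstar, 0 < hstar <= T /\
  forall (x : 'rV[R]_n) (u : 'rV[R]_m) (w : R -> 'rV[R]_p) (k : nat) (h : R),
    Linfty w -> enorm x <= Dx -> enorm u <= Du ->
    (supnorm (sampling_interval T k) w <= Dw%:E)%E -> 0 < h < hstar ->
  forall y, exact_model f T x u (wseg w T k) y ->
    enorm (y - Fa T h x u (wseg w T k)) <= T * rho h.

Definition uniformly_locally_lipschitz (R : realType) (n m : nat)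
    (uc : control_family R n m) : Prop :=
  forall Dx : R, 0 < Dx ->
  exists Tstar L : R, 0 < Tstar /\ 0 < L /\
  forall T, 0 < T < Tstar ->
  exists hstar, 0 < hstar <= T /\
  forall h, 0 < h < hstar ->
  forall x1 x2 : 'rV[R]_n, Num.max (enorm x1) (enorm x2) <= Dx ->
    enorm (uc T h x2 - uc T h x1) <= L * enorm (x2 - x1).

Definition lyapunov_SP_iIiSS (R : realType) (n p : nat)
    (F : R -> R -> 'rV[R]_n -> segment R p -> 'rV[R]_n) : Prop :=
  exists alow aup alpha ghat : R -> R,
  classKoo alow /\ classKoo aup /\ classKoo alpha /\ classK ghat /\
  forall D1 D2 D3 d1 : R, 0 < D1 -> 0 < D2 -> 0 < D3 -> 0 < d1 ->
  exists Tstar M : R, 0 < Tstar /\ 0 < M /\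
  forall T, 0 < T < Tstar ->
  exists hstar, 0 < hstar <= T /\
  forall h, 0 < h < hstar ->
  exists V : 'rV[R]_n -> R,
  [/\ continuous V, forall x, 0 <= V x,
      forall (x : 'rV[R]_n) (w : R -> 'rV[R]_p), enorm x <= D1 ->
        Linfty_lt D2 w -> Lgamma_lt ghat D3 w ->
        alow (enorm x) <= V x <= aup (enorm x) /\
        forall k : nat,
          V (F T h x (wseg w T k)) - V x <=
            T * (- alpha (enorm x)
                 + T^-1 * \int[leb]_(s in sampling_interval T k)
                            ghat (enorm (w s))
                 + d1) &
      forall x1 x2 : 'rV[R]_n, Num.max (enorm x1) (enorm x2) <= D1 ->
        `|V x1 - V x2| <= M * enorm (x1 - x2)].

(* [sol T h w x]: the sequence x, defined for all k, is a solution of the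
   family with parameters T, h under the disturbance w. *)
Definition SP_iIiSS (R : realType) (n p : nat)
    (sol : R -> R -> (R -> 'rV[R]_p) -> (nat -> 'rV[R]_n) -> Prop) : Prop :=
  exists alpha chi gamma : R -> R,
  classKoo alpha /\ classKoo chi /\ classK gamma /\
  forall Dx Dw d : R, 0 < Dx -> 0 < Dw -> 0 < d ->
  exists Tstar : R, 0 < Tstar /\
  forall T, 0 < T < Tstar ->
  exists hstar, 0 < hstar <= T /\
  forall (w : R -> 'rV[R]_p) (x0 : 'rV[R]_n) (h : R),
    Linfty_lt Dw w -> enorm x0 <= Dx -> 0 < h < hstar ->
    (exists x, x 0%N = x0 /\ sol T h w x) /\
    (forall x, x 0%N = x0 -> sol T h w x ->
     forall k : nat,
       T * \sum_(i < k) alpha (enorm (x i)) <=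
         chi (enorm (x 0%N))
         + \int[leb]_(s in `[0, k%:R * T]) gamma (enorm (w s))
         + T * k%:R * d).

(* Main.v *)
(* Along the exact dual-rate loop the Lyapunov function V of the single-rate
   approximate loop still dissipates.  Up to its Lipschitz constant M, which does
   not depend on T and h, the extra increment of V over one period is the distance
   between the exact step with input u(x_c) and the approximate step with input
   u(x).  That distance is at most T (K (T + |u(x_c) - u(x)|) + rho(h)): two exact
   solutions on the same period stay within O(T) of their common initial state, so
   the Lipschitz bound on f needs no Gronwall argument.  Moreover |x_c - x| = O(l T),
   since both sequences start from the same measured state and move by O(T) per
   step.  Hence the extra increment is T times a quantity made small by T, then h.
   The disturbance is only bounded, not of finite energy, but alpha is unbounded,
   so V decreases outside a ball and a sublevel set of V is invariant; the Lyapunov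
   inequality is applied to w truncated to the current period. *)
Require Import Defs.
From mathcomp Require Import all_boot all_order all_algebra.
From mathcomp Require Import all_classical all_reals all_analysis.
From mathcomp Require Import measurable_realfun.
From mathcomp Require Import ring lra.

Set Implicit Arguments.
Unset Strict Implicit.
Unset Printing Implicit Defensive.

Import Order.TTheory GRing.Theory Num.Theory.
Import numFieldNormedType.Exports.

Local Open Scope classical_set_scope.
Local Open Scope ring_scope.

(** * Euclidean norm and Lipschitz bounds on bounded sets *)

Section EuclideanNorm.
Context {R : realType}.
Implicit Types n : nat.

Lemma enorm_ge0 n (x : 'rV[R]_n) : 0 <= enorm x.
Proof. exact: sqrtr_ge0. Qed.

Lemma sum_sqr_ge0 n (x : 'rV[R]_n) : 0 <= \sum_(i < n) x 0 i ^+ 2.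
Proof. by apply: sumr_ge0 => i _; exact: sqr_ge0. Qed.

Lemma enorm0 n : enorm (0 : 'rV[R]_n) = 0.
Proof.
by rewrite /enorm big1 ?sqrtr0// => i _; rewrite mxE expr0n.
Qed.

Lemma enormN n (x : 'rV[R]_n) : enorm (- x) = enorm x.
Proof.
by rewrite /enorm; congr Num.sqrt; apply: eq_bigr => i _; rewrite mxE sqrrN.
Qed.

Lemma enorm_distC n (x y : 'rV[R]_n) : enorm (x - y) = enorm (y - x).
Proof. by rewrite -enormN opprB. Qed.

Lemma normr_coord_le_enorm n (x : 'rV[R]_n) i : `|x 0 i| <= enorm x.
Proof.
rewrite -sqrtr_sqr ler_wsqrtr// (bigD1 i)//= lerDl.
by apply: sumr_ge0 => j _; exact: sqr_ge0.
Qed.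

Lemma enorm_eq0 n (x : 'rV[R]_n) : enorm x = 0 -> x = 0.
Proof.
move=> x0; apply/rowP => i; rewrite mxE; apply/normr0_eq0/le_anti.
by rewrite normr_ge0 andbT -x0 normr_coord_le_enorm.
Qed.

(** With [A] and [B] the squared norms and [P] the inner product, expanding the sum of the squares
    of [B x_i - P y_i] gives [B (A B - P^2) >= 0], and [B > 0] can be divided out. *)
Lemma cauchy_schwarz_sum n (x y : 'rV[R]_n) :
  (\sum_(i < n) x 0 i * y 0 i) <= enorm x * enorm y.
Proof.
have [y0|y0] := eqVneq y 0.
  rewrite y0 enorm0 mulr0 big1// => i _; by rewrite mxE mulr0.
have B0 : 0 < enorm y.
  by rewrite lt_neqAle enorm_ge0 andbT eq_sym; apply: contra_neq y0 => /enorm_eq0.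
rewrite /enorm -sqrtrM ?sum_sqr_ge0//.
set A := \sum_(i < n) x 0 i ^+ 2; set B := \sum_(i < n) y 0 i ^+ 2.
set P := \sum_(i < n) x 0 i * y 0 i.
have {}B0 : 0 < B by move: B0; rewrite /enorm sqrtr_gt0.
suff PAB : P ^+ 2 <= A * B.
  by rewrite (le_trans (ler_norm _))// -sqrtr_sqr ler_wsqrtr.
have : 0 <= \sum_(i < n) (B * x 0 i - P * y 0 i) ^+ 2.
  by apply: sumr_ge0 => i _; exact: sqr_ge0.
rewrite (eq_bigr (fun i => B ^+ 2 * x 0 i ^+ 2 + P ^+ 2 * y 0 i ^+ 2
   - (2 * B * P) * (x 0 i * y 0 i))); last by move=> i _; ring.
rewrite sumrB big_split/= -!mulr_sumr -/A -/B -/P.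
have -> : B ^+ 2 * A + P ^+ 2 * B - 2 * B * P * P = B * (A * B - P ^+ 2) by ring.
by rewrite pmulr_rge0// subr_ge0.
Qed.

Lemma enormD n (x y : 'rV[R]_n) : enorm (x + y) <= enorm x + enorm y.
Proof.
have s0 : 0 <= enorm x + enorm y by rewrite addr_ge0 ?enorm_ge0.
rewrite -(ger0_norm s0) -sqrtr_sqr ler_wsqrtr// sqrrD /enorm.
rewrite !sqr_sqrtr ?sum_sqr_ge0// -/(enorm x) -/(enorm y).
rewrite (eq_bigr (fun i => x 0 i ^+ 2 + y 0 i ^+ 2 + 2 * (x 0 i * y 0 i))); last first.
  by move=> i _; rewrite mxE; ring.
rewrite !big_split/= -mulr_sumr.
have := cauchy_schwarz_sum x y.
rewrite mulr2n; lra.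
Qed.

Lemma enorm_dist_triangle n (y x z : 'rV[R]_n) :
  enorm (x - z) <= enorm (x - y) + enorm (y - z).
Proof. by rewrite (le_trans _ (enormD _ _))// addrA subrK. Qed.

Lemma enorm_le_dist n (x y : 'rV[R]_n) : enorm x <= enorm y + enorm (x - y).
Proof. by rewrite (le_trans _ (enormD _ _))// addrC subrK. Qed.

(** The Euclidean norm is at most the sum of the absolute values of the coordinates. The crude
    factor [n] is the price for passing from componentwise integral estimates to [vintegral]. *)
Lemma enorm_le_card n (x : 'rV[R]_n) c :
  (forall i, `|x 0 i| <= c) -> enorm x <= n%:R * c.
Proof.
move=> xc; apply: (@le_trans _ _ (\sum_(i < n) `|x 0 i|)); last first.
  rewrite (le_trans (ler_sum _ (fun i _ => xc i)))//.
  by rewrite sumr_const card_ord mulr_natl.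
have s0 : 0 <= \sum_(i < n) `|x 0 i| by apply: sumr_ge0.
rewrite -[leRHS](ger0_norm s0) -sqrtr_sqr ler_wsqrtr//.
rewrite expr2 mulr_suml ler_sum// => i _.
rewrite -normr_id -real_normK ?num_real// normr_id expr2 ler_wpM2l//.
by rewrite (bigD1 i)//= lerDl sumr_ge0.
Qed.

(** Links the topology, which is that of the max norm, to the Euclidean norm. The radius
    [r / (n + 1)] gives a strict inequality and makes sense for [n = 0]. *)
Lemma enorm_near n (x0 : 'rV[R]_n) (r : R) : 0 < r ->
  \forall x \near x0, enorm (x - x0) < r.
Proof.
move=> r0; apply/nbhs_ballP; exists (r / n.+1%:R) => /=; first by rewrite divr_gt0.
move=> x [_ xx0].
apply: (@le_lt_trans _ _ (n%:R * (r / n.+1%:R))).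
  apply: enorm_le_card => i; rewrite !mxE distrC.
  exact/ltW/(xx0 0 i).
by rewrite mulrA ltr_pdivrMr// mulrC ltr_pM2l// ltr_nat.
Qed.

End EuclideanNorm.

Section LipschitzOnBounded.
Context {R : realType}.

(** Cubes are products of segments, hence compact; they enclose the Euclidean balls. *)
Definition box n (r : R) : set 'rV[R]_n :=
  [set v | forall i, v ord0 i \in `[- r, r]].

Lemma compact_box n r : compact (@box n r).
Proof.
apply: (@rV_compact R n (fun=> `[- r, r]%classic)) => _.
exact: segment_compact.
Qed.

Lemma enorm_box n r (x : 'rV[R]_n) : enorm x <= r -> box r x.
Proof.
move=> xr i; rewrite in_itv/= -ler_norml.
by rewrite (le_trans _ xr)// normr_coord_le_enorm.
Qed.

(* Covering the diagonal uses local Lipschitz continuity; off the diagonal the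
   difference quotient is bounded because numerator is locally bounded and the
   denominator is locally bounded below. *)
Lemma locally_lipschitz_bounded n m p
    (f : 'rV[R]_n -> 'rV[R]_m -> 'rV[R]_p -> 'rV[R]_n) (r : R) :
  locally_lipschitz f ->
  exists2 L, 0 < L & forall x1 x2 u1 u2 w1 w2,
    enorm x1 <= r -> enorm x2 <= r -> enorm u1 <= r -> enorm u2 <= r ->
    enorm w1 <= r -> enorm w2 <= r ->
    enorm (f x1 u1 w1 - f x2 u2 w2) <=
      L * (enorm (x1 - x2) + enorm (u1 - u2) + enorm (w1 - w2)).
Proof.
move=> flip.
pose K3 := (@box n r `*` (@box m r `*` @box p r)).
pose d (z1 z2 : 'rV[R]_n * ('rV[R]_m * 'rV[R]_p)) :=
  enorm (z1.1 - z2.1) + enorm (z1.2.1 - z2.2.1) + enorm (z1.2.2 - z2.2.2).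
pose F (z : 'rV[R]_n * ('rV[R]_m * 'rV[R]_p)) := f z.1 z.2.1 z.2.2.
have d_ge0 z1 z2 : 0 <= d z1 z2 by rewrite !addr_ge0 ?enorm_ge0.
have dC z1 z2 : d z1 z2 = d z2 z1.
  by rewrite /d; congr (_ + _ + _); rewrite enorm_distC.
have dT z2 z1 z3 : d z1 z3 <= d z1 z2 + d z2 z3.
  rewrite /d; have := enorm_dist_triangle z2.1 z1.1 z3.1.
  have := enorm_dist_triangle z2.2.1 z1.2.1 z3.2.1.
  have := enorm_dist_triangle z2.2.2 z1.2.2 z3.2.2; lra.
have d_eq0 z1 z2 : d z1 z2 = 0 -> z1 = z2.
  move: z1 z2 => [x1 [u1 w1]] [x2 [u2 w2]]; rewrite /d /= => d0.
  have := enorm_ge0 (x1 - x2); have := enorm_ge0 (u1 - u2).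
  have := enorm_ge0 (w1 - w2) => hw hu hx.
  have /enorm_eq0/subr0_eq -> : enorm (x1 - x2) = 0 by lra.
  have /enorm_eq0/subr0_eq -> : enorm (u1 - u2) = 0 by lra.
  by have /enorm_eq0/subr0_eq -> : enorm (w1 - w2) = 0 by lra.
have near_d z e : 0 < e -> \forall z' \near z, d z' z < e.
  move=> e0; have e3 : 0 < e / 3 by rewrite divr_gt0.
  exists ([set x | enorm (x - z.1) < e / 3],
    [set u : 'rV[R]_m * 'rV[R]_p | enorm (u.1 - z.2.1) < e / 3 /\ enorm (u.2 - z.2.2) < e / 3]) => /=.
    split; first exact: enorm_near.
    exists ([set x | enorm (x - z.2.1) < e / 3],
      [set x | enorm (x - z.2.2) < e / 3]) => //=.
    by split; apply: enorm_near.
  move=> z' /= [H1 [H2 H3]]; rewrite /d; lra.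
have Fl z : exists rL : R * R, [/\ 0 < rL.1, 0 <= rL.2 & forall z1 z2,
    d z1 z < rL.1 -> d z2 z < rL.1 -> enorm (F z1 - F z2) <= rL.2 * d z1 z2].
  have [r0 [L [r00 H]]] := flip z.1 z.2.1 z.2.2.
  exists (r0, `|L|); split => //= z1 z2 h1 h2.
  apply: (@le_trans _ _ (L * d z1 z2)); last by rewrite ler_wpM2r// ler_norm.
  move: h1 h2; rewrite /d => h1 h2.
  have := enorm_ge0 (z1.1 - z.1); have := enorm_ge0 (z1.2.1 - z.2.1).
  have := enorm_ge0 (z1.2.2 - z.2.2).
  have := enorm_ge0 (z2.1 - z.1); have := enorm_ge0 (z2.2.1 - z.2.1).
  have := enorm_ge0 (z2.2.2 - z.2.2) => *.
  by apply: H; lra.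
have cK : compact (K3 `*` K3).
  have c3 : compact K3.
    by apply: compact_setX; [|apply: compact_setX]; exact: compact_box.
  exact: compact_setX.
(* The parameter of the near-covering is the Lipschitz constant itself, taken near infinity: local
   bounds become one constant for all pairs in [K3]. *)
move/compact_near_coveringP : cK => /(_ R (pinfty_nbhs R)
  (fun M z => enorm (F z.1 - F z.2) <= M * d z.1 z.2) _) [].
  move=> [z1 z2] _.
  have [[r1 L1] /= [r10 L10 H1]] := Fl z1.
  have [[r2 L2] /= [r20 L20 H2]] := Fl z2.
  have pairnear (P : ('rV[R]_n * ('rV[R]_m * 'rV[R]_p)) -> ('rV[R]_n * ('rV[R]_m * 'rV[R]_p)) -> R -> Prop) e M0 :
    0 < e -> (forall z1' z2' M, d z1' z1 < e -> d z2' z2 < e -> M0 < M -> P z1' z2' M) ->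
    \forall z' \near (z1, z2) & M \near pinfty_nbhs R, P z'.1 z'.2 M.
    move=> e0 HP.
    exists ([set z' | d z'.1 z1 < e /\ d z'.2 z2 < e], [set M | M0 < M]) => /=.
      split; last by exists M0; split => //; exact: num_real.
      exists ([set z' | d z' z1 < e], [set z' | d z' z2 < e]) => //=.
      by split; apply: near_d.
    by move=> [z' M] /= [[h1 h2] h3]; apply: HP.
  have [d0|d0] := eqVneq (d z1 z2) 0.
    apply: (pairnear (fun a b M => enorm (F a - F b) <= M * d a b) r1 L1) => //.
    move=> a b M h1 h2 h3; apply: (le_trans (H1 _ _ h1 _)).
      by rewrite (d_eq0 _ _ d0).
    by rewrite ler_wpM2r// ltW.
  have {}d0 : 0 < d z1 z2 by rewrite lt_neqAle eq_sym d0 d_ge0.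
  set D := d z1 z2 in d0.
  (* Points moved by less than [D / 4] stay at distance at least [D / 2], while the numerator stays
     below [B]; any constant above [B / (D / 2)] works. *)
  pose e := Num.min (Num.min r1 r2) (D / 4).
  have e0 : 0 < e by rewrite !lt_min r10 r20 divr_gt0.
  pose B := L1 * e + L2 * e + enorm (F z1 - F z2).
  have B0 : 0 <= B by rewrite !addr_ge0 ?enorm_ge0 ?mulr_ge0// ltW.
  apply: (pairnear (fun a b M => enorm (F a - F b) <= M * d a b) e (B / (D / 2))) => //.
  move=> a b M ha hb hM.
  have [er1 er2 eD] : [/\ e <= r1, e <= r2 & e <= D / 4].
    by rewrite /e !ge_min !lexx ?orbT.
  have h1 := H1 _ _ (lt_le_trans ha er1) (_ : d z1 z1 < r1).
  have h2 := H2 _ _ (lt_le_trans hb er2) (_ : d z2 z2 < r2).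
  have dzz z : d z z = 0 by rewrite /d !subrr !enorm0 !addr0.
  rewrite !dzz in h1 h2; have {h1}h1 := h1 r10; have {h2}h2 := h2 r20.
  have dab : D / 2 <= d a b.
    have := dT a z1 z2; have := dT b a z2; rewrite (dC z1 a) -/D; lra.
  apply: (@le_trans _ _ B).
    have := enorm_dist_triangle (F z1) (F a) (F b).
    have := enorm_dist_triangle (F z2) (F z1) (F b).
    rewrite (enorm_distC (F z2)) /B.
    have : L1 * d a z1 <= L1 * e by rewrite ler_wpM2l// ltW.
    have : L2 * d b z2 <= L2 * e by rewrite ler_wpM2l// ltW.
    lra.
  have D2 : 0 < D / 2 by rewrite divr_gt0.
  move: hM; rewrite ltr_pdivrMr// => hM.
  apply: (le_trans (ltW hM)); rewrite ler_wpM2l//.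
  rewrite -(pmulr_lge0 _ D2); exact: le_trans B0 (ltW hM).
(* The bound holds for constants strictly above [M], hence the [+ 1]; the maximum makes the constant
   positive. *)
move=> M [_ HM]; exists (Num.max M 0 + 1).
  by rewrite ltr_wpDl// le_max lexx orbT.
move=> x1 x2 u1 u2 w1 w2 *.
apply: (HM _ _ ((x1, (u1, w1)), (x2, (u2, w2)))).
  by rewrite ltr_pwDr// le_max lexx.
by split; split => //=; try split; exact: enorm_box.
Qed.

End LipschitzOnBounded.

(** * Lebesgue measurability and integrals *)

Section MeasurableComposition.
Context {R : realType}.

(** The preimage of an open interval under [G] is open, hence a countable union of boxes with
    rational centres and radii [1 / (k + 1)]; lying in a box is a condition on each coordinate
    separately. *)
Lemma measurable_comp_rV d (T : measurableType d) N (D : set T)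
    (z : T -> 'rV[R]_N) (G : 'rV[R]_N -> R) :
  (forall i, measurable_fun D (fun t => z t 0 i : measurableTypeR R)) -> continuous G ->
  measurable_fun D (fun t => G (z t) : measurableTypeR R).
Proof.
move=> mz cG mD.
suff : measurable_fun D (fun t => G (z t) : measurableTypeR R) by apply.
apply: (measurability _ (RGenOpens.measurableE R)).
move=> _ [_ [a [b ->] <-]].
have oU : open (G @^-1` `]a, b[%classic).
  by move/continuousP : cG; apply; exact: interval_open.
set U := G @^-1` _ in oU.
pose box (qk : 'rV[rat]_N * nat) : set 'rV[R]_N :=
  [set v | forall i, `|v 0 i - ratr (qk.1 0 i)| < qk.2.+1%:R^-1].
(* Boxes not contained in [U] contribute the empty set, so that the union runs over a whole
   countable type. *)
pose E (qk : 'rV[rat]_N * nat) : set T :=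
  if `[< box qk `<=` U >] then D `&` z @^-1` box qk else set0.
have -> : D `&` (fun t => G (z t)) @^-1` `]a, b[%classic = \bigcup_qk E qk.
  apply/seteqP; split=> [t [Dt Gt]|t [qk _]]; last first.
    by rewrite /E; case: ifPn => // /asboolP bU [Dt bt]; split => //; exact: bU.
  have Ut : U (z t) by [].
  have : nbhs (z t) U by move: oU => /(_ _ Ut).
  move=> /nbhs_ballP[e /= e0 eU].
  have [k ke] : exists k, k.+1%:R^-1 < e / 2.
    have e2 : 0 < e / 2 by rewrite divr_gt0.
    exists (Num.truncn (e / 2)^-1).
    rewrite invf_plt ?posrE ?ltr0n//.
    exact: truncnS_gt.
  have k0 : 0 < k.+1%:R^-1 :> R by rewrite invr_gt0.
  have qex i : exists q : rat, `|z t 0 i - ratr q| < k.+1%:R^-1.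
    have [|q qz] := @rat_in_itvoo R (z t 0 i - k.+1%:R^-1) (z t 0 i + k.+1%:R^-1).
      by rewrite ltrD2l gtrN.
    exists q; move: qz; rewrite in_itv/= distrC ltr_distl.
    by [].
  pose q : 'rV[rat]_N := \row_i sval (cid (qex i)).
  have bq : box (q, k) (z t) by move=> i /=; rewrite mxE; case: cid.
  exists (q, k) => //; rewrite /E; case: ifPn => [_//|/asboolP []].
  move=> v bv; apply: eU; split => // i j.
  rewrite ord1 /ball/=.
  rewrite (le_lt_trans (ler_distD (ratr (q 0 j)) _ _))//.
  rewrite (splitr e) ltrD//; first exact: lt_trans (bq j) ke.
  rewrite distrC; exact: lt_trans (bv j) ke.
apply: countable_bigcupT_measurable => [|[q k]]; first exact: countableP.
rewrite /E; case: ifPn => // _.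
pose F i := D `&` (fun t => z t 0 i) @^-1` [set r | ~ (`|r - ratr (q 0 i)| < k.+1%:R^-1)].
have -> : D `&` z @^-1` box (q, k) = D `\` \bigcup_i F i.
  apply/seteqP; split=> t [Dt].
    by move=> bt; split => // -[i _ [_]] /=; apply; exact: bt.
  move=> nF; split => // i; apply: contrapT => ni; apply: nF.
  by exists i.
apply: measurableD => //.
apply: countable_bigcupT_measurable; first exact: countableP.
move=> i; apply: mz => //.
rewrite [X in measurable X](_ : _ =
  ~` `](ratr (q 0 i) - k.+1%:R^-1), (ratr (q 0 i) + k.+1%:R^-1)[%classic).
  exact: measurableC.
by apply/seteqP; split => r /=; rewrite in_itv/= ltr_distl.
Qed.

End MeasurableComposition.

Section LebesgueIntegral.
Context {R : realType}.
Implicit Types (g : R -> R) (a b s t C : R).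

Lemma measurable_lebesgueType (A : set R) :
  measurable A -> @measurable _ (lebesgueType R) A.
Proof. by move=> mA; apply: sub_caratheodory. Qed.

Lemma measurable_itv_leb (i : interval R) :
  @measurable _ (lebesgueType R) [set` i].
Proof. exact: measurable_lebesgueType. Qed.

Lemma leb_itv (i : interval R) : leb ([set` i] : set R) =
  (if i.1 < i.2 then (i.2 : \bar R) - i.1 else 0)%E.
Proof. exact: lebesgue_measure_itv. Qed.

Lemma leb_itv_bnd (x y : bool) a b : a <= b ->
  leb ([set` Interval (BSide x a) (BSide y b)] : set R) = (b - a)%:E.
Proof.
move=> ab; rewrite leb_itv /= lte_fin; case: ltP => [_|ba]; first by rewrite -EFinB.
by rewrite (le_anti (introT andP (conj ab ba))) subrr.
Qed.

Lemma leb_itv_lt_pinfty (x y : bool) a b :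
  (leb ([set` Interval (BSide x a) (BSide y b)] : set R) < +oo)%E.
Proof.
by rewrite leb_itv /=; case: ifP => _; rewrite ?ltry// -EFinB ltry.
Qed.

Lemma integrable_leb_bounded g a b C :
  @measurable_fun _ _ (lebesgueType R) (measurableTypeR R) `[a, b] g ->
  (forall t, a <= t <= b -> `|g t| <= C) ->
  leb.-integrable `[a, b] (fun s => (g s)%:E).
Proof.
move=> mg gC.
apply: (@measurable_bounded_integrable _ (lebesgueType R) R leb g).
- exact: measurable_itv_leb.
- exact: leb_itv_lt_pinfty.
- exact: mg.
exists C; split; first exact: num_real.
move=> M CM t; rewrite /= in_itv/= => /gC h; exact: le_trans h (ltW CM).
Qed.

Lemma Rintegral_leb_set1 g t : \int[leb]_(s in [set t]) g s = 0.
Proof.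
rewrite (@eq_Rintegral _ (lebesgueType R) R leb [set t] (cst (g t))); last first.
  by move=> x; rewrite inE /= => ->.
rewrite Rintegral_cst.
  rewrite (_ : fine _ = 0) ?mulr0//.
  by rewrite -[RHS]/(fine 0%E); congr fine; exact: lebesgue_measure_set1.
exact/measurable_lebesgueType.
Qed.

Lemma Rintegral_leb_split g a s t : a <= s -> s <= t ->
  leb.-integrable `[a, t] (fun x => (g x)%:E) ->
  \int[leb]_(x in `[a, t]) g x =
  \int[leb]_(x in `[a, s]) g x + \int[leb]_(x in `]s, t]) g x.
Proof.
move=> as_ st ig.
have E : `[a, t]%classic = `[a, s]%classic `|` `]s, t]%classic :> set R.
  by apply: itv_bndbnd_setU; rewrite bnd_simp.
rewrite {1}E Rintegral_setU//.
- exact: measurable_itv_leb.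
- exact: measurable_itv_leb.
- by rewrite -E.
- apply/disj_setPS => x /= []; rewrite !in_itv/= => /andP[_ xs] /andP[sx _].
  by move: (lt_le_trans sx xs); rewrite ltxx.
Qed.

(** The bound on [g] is assumed only before [t]: in the continuation argument for plant solutions
    the value at [t] is precisely what is being estimated. The end point is a null set. *)
Lemma Rintegral_leb_norm_le g a t C : a <= t ->
  leb.-integrable `[a, t] (fun x => (g x)%:E) ->
  (forall s, a <= s < t -> `|g s| <= C) ->
  `|\int[leb]_(x in `[a, t]) g x| <= C * (t - a).
Proof.
move=> at_ ig gC.
have [<-|neq] := eqVneq a t.
  rewrite subrr mulr0 set_itv1 Rintegral_leb_set1 normr0//.
have {neq}at_ : a < t by rewrite lt_neqAle neq.
have E : `[a, t]%classic = `[a, t[%classic `|` [set t] :> set R.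
  by rewrite (@setUitv1 _ R (BLeft a) t true)// bnd_simp ltW.
have ig' : leb.-integrable `[a, t[ (fun x => (g x)%:E).
  apply: (@integrableS _ (lebesgueType R) R leb `[a, t]%classic); last exact: ig.
  - exact: measurable_itv_leb.
  - exact: measurable_itv_leb.
  - by rewrite E; left.
have mt : @measurable _ (lebesgueType R) [set t] by exact/measurable_lebesgueType.
rewrite E Rintegral_setU//; last 3 first.
- exact: measurable_itv_leb.
- by rewrite -E.
- by apply/disj_setPS => x /= [] /[swap] ->; rewrite in_itv/= ltxx andbF.
rewrite Rintegral_leb_set1 addr0.
apply: (le_trans (le_normr_Rintegral _ ig')); first exact: measurable_itv_leb.
apply: (@le_trans _ _ (\int[leb]_(x in `[a, t[) C)).
  apply: le_Rintegral.
  - exact: measurable_itv_leb.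
  - exact: integrable_norm.
  - apply: (@measurable_bounded_integrable _ (lebesgueType R) R leb (cst C)).
    + exact: measurable_itv_leb.
    + exact: leb_itv_lt_pinfty.
    + exact: measurable_cst.
    + exists `|C|; split; first exact: num_real.
      by move=> M CM x _ /=; exact: ltW.
  - by move=> x /=; rewrite in_itv/= => /gC.
rewrite Rintegral_cst; last exact: measurable_itv_leb.
rewrite (_ : fine _ = t - a)//.
rewrite -[RHS]/(fine (t - a)%:E); congr fine; exact/leb_itv_bnd/ltW.
Qed.

(** This is absolute continuity of the integral: [g] is extended by zero to an integrable function
    on the line, and the increment is its integral over []s, t]], of measure [t - s]. *)
Lemma Rintegral_leb_uniform_continuous g a b e : 0 < e ->
  leb.-integrable `[a, b] (fun x => (g x)%:E) ->
  exists2 d, 0 < d & forall s t, a <= s -> s <= t -> t <= b -> t - s < d ->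
    `|\int[leb]_(x in `[a, t]) g x - \int[leb]_(x in `[a, s]) g x| < e.
Proof.
move=> e0 ig.
pose G := g \_ `[a, b].
have iG : (leb : {measure set lebesgueType R -> \bar R}).-integrable setT (EFin \o G).
  have mab := measurable_itv_leb `[a, b].
  by rewrite /G -restrict_EFin; apply/(integrable_mkcond _ mab).
have [d [d0 H]] := integral_normr_continuous iG e0.
exists d => // s t as_ st tb std.
have igt : leb.-integrable `[a, t] (fun x => (g x)%:E).
  apply: (@integrableS _ (lebesgueType R) R leb `[a, b]%classic); last exact: ig.
  - exact: measurable_itv_leb.
  - exact: measurable_itv_leb.
  - by apply: subset_itvl; rewrite bnd_simp.
rewrite (Rintegral_leb_split as_ st igt) addrC addKr.
have mst := measurable_itv_leb `]s, t].
apply: le_lt_trans (H `]s, t]%classic mst _); last first.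
  apply: (@le_lt_trans _ _ (t - s)%:E); last by rewrite lte_fin.
  have <- := leb_itv_bnd false false st; exact: lexx.
have E x : `]s, t]%classic x -> G x = g x.
  rewrite /= in_itv/= => /andP[sx xt]; rewrite /G patchE mem_set//= in_itv/=.
  by rewrite (le_trans as_ (ltW sx)) (le_trans xt tb).
rewrite -(@eq_Rintegral _ (lebesgueType R) R leb `]s, t]%classic g G); last first.
  by move=> x /set_mem /E.
apply: le_normr_Rintegral => //.
apply: (eq_integrable mst (EFin \o G)).
  by move=> x /set_mem /E /= ->.
apply: integrableS iG => //.
Qed.

End LebesgueIntegral.

(** * Geometric convergence, continuity in the Euclidean norm, measurability of the plant field *)

Section Auxiliary.
Context {R : realType}.

(** Merges radii found coordinate by coordinate; the [1] in the minimum covers [n = 0]. *)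
Lemma exists_common_radius n (P : 'I_n -> R -> Prop) :
  (forall i d d', P i d -> d' <= d -> P i d') ->
  (forall i, exists2 d, 0 < d & P i d) -> exists2 d, 0 < d & forall i, P i d.
Proof.
move=> mono /(_ _)/cid2 d_; pose d i := s2val (d_ i).
exists (\big[Num.min/1]_i d i).
  by apply: lt_bigmin => // i _; rewrite /d; case: (d_ i).
by move=> i; apply: (mono i (d i)); [rewrite /d; case: (d_ i)|exact: bigmin_le].
Qed.

Lemma exists_half_expr_lt (e : R) : 0 < e -> exists k, 2^-1 ^+ k < e.
Proof.
move=> e0; exists (Num.truncn e^-1); set k := Num.truncn _.
have k2 : e^-1 < 2 ^+ k.
  rewrite (lt_le_trans (truncnS_gt _))// -/k.
  by rewrite -natrX ler_nat ltn_expl.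
by rewrite exprVn invf_plt ?posrE ?exprn_gt0.
Qed.

(* The sequences u k -/+ 2^(1-k) are monotone and bound the limit from both
   sides. *)
Lemma half_cauchy_limit (u : nat -> R) :
  (forall k, `|u k.+1 - u k| <= 2^-1 ^+ k) ->
  exists l, forall k, `|u k - l| <= 2 * 2^-1 ^+ k.
Proof.
move=> hu; pose e k : R := 2 * 2^-1 ^+ k.
have e0 k : 0 <= e k by rewrite mulr_ge0// exprn_ge0// invr_ge0.
have eS k : e k - e k.+1 = 2^-1 ^+ k by rewrite /e exprS; field.
have up j k : u j - e j <= u (j + k)%N - e (j + k)%N.
  elim: k => [|k ih]; first by rewrite addn0.
  rewrite (le_trans ih)// addnS; have := eS (j + k)%N.
  have := hu (j + k)%N; rewrite ler_norml => /andP[]; lra.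
have down j k : u (j + k)%N + e (j + k)%N <= u j + e j.
  elim: k => [|k ih]; first by rewrite addn0.
  rewrite (le_trans _ ih)// addnS; have := eS (j + k)%N.
  have := hu (j + k)%N; rewrite ler_norml => /andP[]; lra.
have cross j k : u j - e j <= u k + e k.
  apply: (le_trans (up j k)); apply: le_trans (down k j); rewrite (addnC k j).
  have := e0 (j + k)%N; lra.
pose A := [set u k - e k | k in [set: nat]].
have A0 : A !=set0 by exists (u 0%N - e 0%N), 0%N.
have Aub k : ubound A (u k + e k) by move=> _ [j _ <-].
exists (sup A) => k; rewrite -/(e k) ler_norml; apply/andP; split.
  have : sup A <= u k + e k by exact: ge_sup.
  lra.
have : u k - e k <= sup A.
  by apply: ub_le_sup; [exists (u 0%N + e 0%N)|exists k].
lra.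
Qed.

Lemma continuous_enorm_eps N (G : 'rV[R]_N -> R) :
  (forall z0 e, 0 < e -> exists2 d, 0 < d &
    forall z, enorm (z - z0) < d -> `|G z - G z0| < e) -> continuous G.
Proof.
move=> H z0; apply/(@cvgrPdist_lt _ _ _ (nbhs z0) (nbhs_filter z0)) => e e0.
have [d d0 Hd] := H z0 e e0.
apply: (@filterS _ (nbhs z0) (nbhs_filter z0)) (enorm_near z0 d0) => z /Hd.
by rewrite distrC.
Qed.

Lemma enorm_lsubmx_le n p (z : 'rV[R]_(n + p)) : enorm (lsubmx z) <= enorm z.
Proof.
rewrite ler_wsqrtr// big_split_ord/=.
rewrite (eq_bigr (fun i => z 0 (lshift p i) ^+ 2)) ?lerDl; last by move=> i _; rewrite mxE.
by apply: sumr_ge0 => i _; exact: sqr_ge0.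
Qed.

Lemma enorm_rsubmx_le n p (z : 'rV[R]_(n + p)) : enorm (rsubmx z) <= enorm z.
Proof.
rewrite ler_wsqrtr// big_split_ord/=.
rewrite (eq_bigr (fun i => z 0 (rshift n i) ^+ 2)) ?lerDr; last by move=> i _; rewrite mxE.
by apply: sumr_ge0 => i _; exact: sqr_ge0.
Qed.

End Auxiliary.

Section Plant.
Context {R : realType} {n m p : nat}.
Variable f : 'rV[R]_n -> 'rV[R]_m -> 'rV[R]_p -> 'rV[R]_n.

(** For fixed [u] the field is a continuous function of the single row vector
    [row_mx (phi t) (v t)], whose coordinates are measurable. *)
Lemma measurable_plant_field (f_lip : locally_lipschitz f) (D : set R) (u : 'rV[R]_m)
    (phi : R -> 'rV[R]_n) (v : R -> 'rV[R]_p) i :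
  (forall i, @measurable_fun _ _ (lebesgueType R) (measurableTypeR R) D
    (fun t => phi t 0 i)) ->
  (forall i, @measurable_fun _ _ (lebesgueType R) (measurableTypeR R) D
    (fun t => v t 0 i)) ->
  @measurable_fun _ _ (lebesgueType R) (measurableTypeR R) D
    (fun t => f (phi t) u (v t) 0 i).
Proof.
move=> mphi mv.
pose G (z : 'rV[R]_(n + p)) := f (lsubmx z) u (rsubmx z) 0 i.
have cG : continuous G.
  apply: continuous_enorm_eps => z0 e e0.
  have [r [L [r0 H]]] := f_lip (lsubmx z0) u (rsubmx z0).
  (* The sign of [L] is not known, hence [|L| + 1]; the factor [2] counts the two blocks, each
     moving by at most [enorm (z - z0)]. *)
  pose d := Num.min r (e / (2 * (`|L| + 1))).
  have L1 : 0 < `|L| + 1 by rewrite ltr_pwDr.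
  exists d; first by rewrite lt_min r0 divr_gt0// mulr_gt0.
  move=> z; rewrite lt_min => /andP[zr zd].
  have hl : enorm (lsubmx z - lsubmx z0) <= enorm (z - z0).
    by rewrite -linearB enorm_lsubmx_le.
  have hr : enorm (rsubmx z - rsubmx z0) <= enorm (z - z0).
    by rewrite -linearB enorm_rsubmx_le.
  have := H (lsubmx z) (lsubmx z0) u u (rsubmx z) (rsubmx z0).
  rewrite !subrr !enorm0 addr0 => /(_ (le_lt_trans hl zr) r0 r0 r0
    (le_lt_trans hr zr) r0) h.
  have -> : G z - G z0 = (f (lsubmx z) u (rsubmx z) -
     f (lsubmx z0) u (rsubmx z0)) 0 i by rewrite !mxE.
  rewrite (le_lt_trans (normr_coord_le_enorm _ _))// (le_lt_trans h)//.
  set S := enorm _ + enorm _ in h *.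
  have S0 : 0 <= S by rewrite addr_ge0 ?enorm_ge0.
  have SL : L * S <= (`|L| + 1) * S.
    by rewrite ler_wpM2r// (le_trans (ler_norm _))// lerDl.
  rewrite (le_lt_trans SL)//.
  apply: (@le_lt_trans _ _ ((`|L| + 1) * (2 * enorm (z - z0)))).
    rewrite ler_pM2l//; rewrite /S; lra.
  move: zd; rewrite ltr_pdivlMr ?mulr_gt0//; lra.
pose z t := row_mx (phi t) (v t).
rewrite (_ : (fun t => _) = (fun t => G (z t))); last first.
  by apply/funext => t; rewrite /G /z row_mxKl row_mxKr.
apply: (measurable_comp_rV _ cG) => j; rewrite /z.
have [j' ->|j' ->] := split_ordP j.
  by rewrite (_ : (fun t => _) = (fun t => phi t 0 j')) //; apply/funext => t; rewrite row_mxEl.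
by rewrite (_ : (fun t => _) = (fun t => v t 0 j')) //; apply/funext => t; rewrite row_mxEr.
Qed.

End Plant.

(** * Existence and a priori bounds for plant solutions *)

Section PlantSolution.
Context {R : realType} {n m p : nat}.
Variable f : 'rV[R]_n -> 'rV[R]_m -> 'rV[R]_p -> 'rV[R]_n.
Variables (a b C : R) (x : 'rV[R]_n) (u : 'rV[R]_m) (v : R -> 'rV[R]_p).
Hypothesis ab : a <= b.
Hypothesis C0 : 0 <= C.
Hypothesis f_le : forall t y, a <= t <= b -> enorm (y - x) <= 1 ->
  enorm (f y u (v t)) <= C.
Hypothesis CT : n%:R * (C * (b - a)) <= 2^-1.

Lemma integrable_leb_sub g t : a <= t <= b ->
  leb.-integrable `[a, b] (fun s => (g s : R)%:E) ->
  leb.-integrable `[a, t] (fun s => (g s)%:E).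
Proof.
move=> /andP[at_ tb] ig.
apply: (@integrableS _ (lebesgueType R) R leb `[a, b]%classic); last exact: ig.
- exact: measurable_itv_leb.
- exact: measurable_itv_leb.
- by apply: subset_itvl; rewrite bnd_simp.
Qed.

Lemma vintegral_plant_le phi t : a <= t <= b ->
  (forall i, leb.-integrable `[a, b] (fun s => (f (phi s) u (v s) 0 i)%:E)) ->
  (forall s, a <= s < t -> enorm (phi s - x) <= 1) ->
  enorm (vintegral `[a, t] (fun s => f (phi s) u (v s))) <=
    n%:R * (C * (t - a)).
Proof.
move=> /[dup] atb /andP[at_ tb] ig phi1; apply: enorm_le_card => i; rewrite mxE.
apply: Rintegral_leb_norm_le => //; first exact: integrable_leb_sub.
move=> s /[dup] /phi1 h /andP[as_ st].
rewrite (le_trans (normr_coord_le_enorm _ _))// f_le// as_.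
exact/ltW/(lt_le_trans st).
Qed.

(** The bound [C] is available only in the unit ball around [x], so a continuation argument shows
    that the solution never leaves it. Let [t0] be the infimum of the times spent outside: the
    integral estimate up to [t0] gives distance at most [1/2] there, and continuity keeps the
    solution inside for a while after [t0]. *)
Lemma plant_solution_bound phi : plant_solution f a b x u v phi ->
  forall t, a <= t <= b -> enorm (phi t - x) <= n%:R * (C * (b - a)).
Proof.
move=> [ig phiE].
have step t : a <= t <= b -> (forall s, a <= s < t -> enorm (phi s - x) <= 1) ->
    enorm (phi t - x) <= n%:R * (C * (b - a)).
  move=> /[dup] atb /andP[at_ tb] h; rewrite phiE// [x + _]addrC addrK.
  apply: (le_trans (vintegral_plant_le atb ig h)).
  by rewrite ler_wpM2l// ler_wpM2l// lerB.
suff H s : a <= s <= b -> enorm (phi s - x) <= 1.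
  move=> t /[dup] atb /andP[at_ tb]; apply: step => // s /andP[as_ st].
  by apply: H; rewrite as_ ltW// (lt_le_trans st).
move=> sab; rewrite leNgt; apply/negP => phis.
pose B := [set s | a <= s <= b /\ 1 < enorm (phi s - x)].
have Bs : B s by [].
have lbB : lbound B a by move=> z [/andP[]].
have hiB : has_inf B by split; [exists s|exists a].
set t0 := inf B.
have at0 : a <= t0 by apply: lb_le_inf => //; exists s.
have t0lb z : B z -> t0 <= z by move=> Bz; apply: ge_inf => //; exists a.
have t0b : t0 <= b by rewrite (le_trans (t0lb _ Bs))//; case/andP: sab.
have t0ab : a <= t0 <= b by rewrite at0.
have phit0 : enorm (phi t0 - x) <= 2^-1.
  apply: le_trans CT; apply: step => // z /andP[az zt0]; rewrite leNgt; apply/negP => hz.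
  have /t0lb : B z by split => //; rewrite az ltW// (lt_le_trans zt0).
  by rewrite leNgt zt0.
(* Chosen so that [n e <= 1/2], the room left between [1/2] at [t0] and the radius [1]. *)
pose e : R := (2 * n.+1%:R)^-1.
have e0 : 0 < e by rewrite invr_gt0 mulr_gt0.
have [d d0 Hd] : exists2 d, 0 < d & forall i t, t0 <= t -> t <= b -> t - t0 < d ->
    `|(phi t - phi t0) 0 i| <= e.
  apply: (@exists_common_radius R n (fun i d => forall t, t0 <= t -> t <= b ->
    t - t0 < d -> `|(phi t - phi t0) 0 i| <= e)).
    by move=> i d d' H dd' t h1 h2 h3; apply: H => //; exact: lt_le_trans dd'.
  move=> i; have [d d0 H] := Rintegral_leb_uniform_continuous e0 (ig i).
  exists d => // t t0t tb td.
  have atb : a <= t <= b by rewrite (le_trans at0).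
  rewrite (phiE t)// (phiE t0)// opprD addrACA subrr add0r !mxE.
  exact/ltW/H.
have [t Bt tt0] := inf_adherent d0 hiB.
have t0t := t0lb _ Bt; case: Bt => /andP[_ tb]; apply/negP; rewrite -leNgt.
apply: (le_trans (enorm_dist_triangle (phi t0) _ _)).
have : enorm (phi t - phi t0) <= n%:R * e.
  by apply: enorm_le_card => i; apply: Hd => //; rewrite ltrBlDl.
have : n%:R * e <= 2^-1.
  rewrite /e invfM mulrCA ler_piMr// ler_pdivrMr// mul1r ler_nat leqnSn //.
lra.
Qed.

End PlantSolution.

(** * Picard iteration *)

Section Picard.
Context {R : realType} {n m p : nat}.
Variable f : 'rV[R]_n -> 'rV[R]_m -> 'rV[R]_p -> 'rV[R]_n.
Variables (a b C L : R) (x : 'rV[R]_n) (u : 'rV[R]_m) (v : R -> 'rV[R]_p).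
Hypothesis f_lip : locally_lipschitz f.
Hypothesis ab : a <= b.
Hypothesis C0 : 0 <= C.
Hypothesis L0 : 0 <= L.
Hypothesis f_le : forall t y, a <= t <= b -> enorm (y - x) <= 1 ->
  enorm (f y u (v t)) <= C.
Hypothesis f_lipL : forall t y1 y2, a <= t <= b -> enorm (y1 - x) <= 1 ->
  enorm (y2 - x) <= 1 ->
  enorm (f y1 u (v t) - f y2 u (v t)) <= L * enorm (y1 - y2).
Hypothesis CT : n%:R * (C * (b - a)) <= 2^-1.
Hypothesis LT : n%:R * (L * (b - a)) <= 2^-1.
Hypothesis mv : forall i, @measurable_fun _ _ (lebesgueType R) (measurableTypeR R)
  `[a, b] (fun t => v t 0 i).

Fixpoint picard (k : nat) : R -> 'rV[R]_n :=
  if k is j.+1 then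
    fun t => x + vintegral `[a, t] (fun s => f (picard j s) u (v s))
  else fun=> x.

(** A class stable under the Picard map: measurability makes the integrands integrable, and the unit
    ball is where [C] and [L] are valid. *)
Let admissible (phi : R -> 'rV[R]_n) :=
  (forall i, @measurable_fun _ _ (lebesgueType R) (measurableTypeR R)
    `[a, b] (fun t => phi t 0 i)) /\
  (forall t, a <= t <= b -> enorm (phi t - x) <= 1).

Let admissible_integrable phi : admissible phi ->
  forall i, leb.-integrable `[a, b] (fun s => (f (phi s) u (v s) 0 i)%:E).
Proof.
move=> [mphi phi1] i.
apply: (@integrable_leb_bounded _ (fun s => f (phi s) u (v s) 0 i) a b C).
  exact: measurable_plant_field.
move=> t tab; rewrite (le_trans (normr_coord_le_enorm _ _))// f_le//.
exact: phi1.
Qed.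

Let admissible_step phi : admissible phi ->
  admissible (fun t => x + vintegral `[a, t] (fun s => f (phi s) u (v s))).
Proof.
move=> aphi; have ig := admissible_integrable aphi; split.
  move=> i.
  (* The image is continuous in the upper limit of integration, hence Borel measurable on [[a, b]],
     hence Lebesgue measurable. *)
  have mb : measurable_fun (`[a, b]%classic : set (measurableTypeR R))
     ((fun t => (x + vintegral `[a, t] (fun s => f (phi s) u (v s))) 0 i) : R -> measurableTypeR R).
    apply: subspace_continuous_measurable_fun; first exact: measurable_itv.
    apply/subspace_continuousP => t /=; rewrite in_itv/= => tab.
    apply/cvgrPdist_lt => e e0.
    have [d d0 H] := Rintegral_leb_uniform_continuous e0 (ig i).
    rewrite near_withinE; exists d => //= s /= ts; rewrite in_itv/= => sab.
    rewrite !mxE opprD addrACA subrr add0r.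
    case/andP: tab => at_ tb; case/andP: sab => as_ sb.
    have [st|st] := leP s t; last rewrite distrC.
      by apply: H => //; rewrite (le_lt_trans (ler_norm _)).
    by apply: H => //; rewrite ?(ltW st)// -opprB (le_lt_trans (ler_norm _))// normrN.
  move=> _ Y mY.
  apply: measurable_lebesgueType; exact: (mb (measurable_itv _) _ mY).
move=> t /[dup] tab /andP[at_ tb]; rewrite [x + _]addrC addrK.
apply: (@le_trans _ _ (n%:R * (C * (t - a)))).
  apply: (vintegral_plant_le f_le tab ig) => s /andP[as_ st]; apply: aphi.2.
  by rewrite as_ ltW// (lt_le_trans st).
apply: (@le_trans _ _ 2^-1); last lra.
by apply: le_trans CT; rewrite ler_wpM2l// ler_wpM2l// lerB.
Qed.

Let picard_admissible k : admissible (picard k).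
Proof.
elim: k => [|k ih]; last exact: admissible_step.
split=> [i|t _]; last by rewrite subrr enorm0.
exact: measurable_cst.
Qed.

(** The Lipschitz bound together with [LT] makes the Picard map a contraction for the uniform
    distance on [[a, b]]. *)
Let vintegral_contract phi psi c : admissible phi -> admissible psi ->
  (forall s, a <= s <= b -> enorm (phi s - psi s) <= c) ->
  forall t, a <= t <= b ->
  enorm (vintegral `[a, t] (fun s => f (phi s) u (v s)) -
         vintegral `[a, t] (fun s => f (psi s) u (v s))) <= 2^-1 * c.
Proof.
move=> aphi apsi hc t /[dup] tab /andP[at_ tb].
have c0 : 0 <= c.
  by apply: le_trans (hc a _); rewrite ?enorm_ge0 ?lexx.
have ig1 i := integrable_leb_sub tab (admissible_integrable aphi i).
have ig2 i := integrable_leb_sub tab (admissible_integrable apsi i).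
apply: (@le_trans _ _ (n%:R * (L * c * (t - a)))).
  apply: enorm_le_card => i; rewrite !mxE.
  rewrite -(@RintegralB _ (lebesgueType R) R leb _ _ _
    (measurable_itv_leb `[a, t]) (ig1 i) (ig2 i)).
  apply: Rintegral_leb_norm_le => //.
    have := @integrableB _ (lebesgueType R) R leb _ (measurable_itv_leb `[a, t]) _ _ (ig1 i) (ig2 i).
    by [].
  move=> s /andP[as_ st]; have sab : a <= s <= b by rewrite as_ ltW// (lt_le_trans st).
  have -> : f (phi s) u (v s) 0 i - f (psi s) u (v s) 0 i =
    (f (phi s) u (v s) - f (psi s) u (v s)) 0 i by rewrite !mxE.
  rewrite (le_trans (normr_coord_le_enorm _ _))//.
  rewrite (le_trans (f_lipL sab (aphi.2 _ sab) (apsi.2 _ sab)))//.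
  by rewrite ler_wpM2l// hc.
have -> : n%:R * (L * c * (t - a)) = (n%:R * (L * (t - a))) * c by ring.
rewrite ler_wpM2r//; apply: le_trans LT.
by rewrite ler_wpM2l// ler_wpM2l// lerB.
Qed.

Let picard_cauchy k t : a <= t <= b ->
  enorm (picard k.+1 t - picard k t) <= 2^-1 ^+ k.
Proof.
elim: k t => [|k ih] t tab.
  rewrite expr0 /=; have := (picard_admissible 1).2 t tab; exact.
rewrite exprS.
have -> : picard k.+2 t - picard k.+1 t =
    vintegral `[a, t] (fun s => f (picard k.+1 s) u (v s)) -
    vintegral `[a, t] (fun s => f (picard k s) u (v s)).
  by rewrite /= opprD addrACA subrr add0r.
exact: vintegral_contract.
Qed.

(** The iterates converge geometrically in each coordinate. Their limit is again admissible, so the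
    contraction compares [picard k.+1] with both the limit and its image, which must agree. *)
Lemma plant_solution_exists : exists phi, plant_solution f a b x u v phi.
Proof.
(* The condition on [t] sits under the existential so that the limit is a total function; its value
   [0] outside [[a, b]] is arbitrary. *)
have lim_ t i : exists l, a <= t <= b ->
    forall k, `|picard k t 0 i - l| <= 2 * 2^-1 ^+ k.
  have [tab|ntab] := boolP (a <= t <= b); last by exists 0.
  have [|l Hl] := @half_cauchy_limit R (fun k => picard k t 0 i); last by exists l.
  move=> k; apply: le_trans (picard_cauchy k tab).
  have -> : picard k.+1 t 0 i - picard k t 0 i =
    (picard k.+1 t - picard k t) 0 i by rewrite !mxE.
  exact: normr_coord_le_enorm.
pose phi t : 'rV[R]_n := \row_i sval (cid (lim_ t i)).
have phi_lim t i k : a <= t <= b -> `|(picard k t - phi t) 0 i| <= 2 * 2^-1 ^+ k.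
  by move=> tab; rewrite !mxE; case: cid => l /= /(_ tab).
have phi_elim t k : a <= t <= b ->
    enorm (picard k t - phi t) <= n%:R * (2 * 2^-1 ^+ k).
  by move=> tab; apply: enorm_le_card => i; exact: phi_lim.
have small (e c : R) : 0 < e -> 0 <= c -> exists k, c * 2^-1 ^+ k <= e.
  move=> e0 c0; have c1 : 0 < c + 1 by rewrite ltr_wpDl.
  have [|k hk] := @exists_half_expr_lt R (e / (c + 1)); first by rewrite divr_gt0.
  exists k; move: hk; rewrite ltr_pdivlMr// => hk; rewrite (le_trans _ (ltW hk))//.
  by rewrite mulrC ler_wpM2l ?exprn_ge0 ?invr_ge0// lerDl.
have aphi : admissible phi.
  split=> [i|t tab].
    apply: (@measurable_fun_cvg _ (lebesgueType R) R _ (fun k t => picard k t 0 i)).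
      by move=> k; exact: (picard_admissible k).1.
    move=> t /=; rewrite in_itv/= => tab.
    apply/cvgrPdist_le => e e0.
    have [|k hk] := small e 2 e0; first exact: ler0n.
    exists k => // j /= kj; rewrite distrC.
    have -> : picard j t 0 i - phi t 0 i = (picard j t - phi t) 0 i by rewrite !mxE.
    rewrite (le_trans (phi_lim t i j tab))// (le_trans _ hk)// ler_wpM2l//.
    by rewrite ler_wiXn2l// ?invr_ge0// invf_le1// ler1n.
  rewrite leNgt; apply/negP => lt1.
  have [||k hk] := small ((enorm (phi t - x) - 1) / 2) (n%:R * 2).
  - by rewrite divr_gt0// subr_gt0.
  - by rewrite mulr_ge0.
  have := phi_elim t k tab; rewrite mulrA => hk2.
  have := (picard_admissible k).2 t tab.
  have := enorm_dist_triangle (picard k t) (phi t) x.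
  rewrite (enorm_distC (phi t) (picard k t)); lra.
exists phi; split; first exact: admissible_integrable.
move=> t tab; apply/subr0_eq/enorm_eq0/le_anti; rewrite enorm_ge0 andbT.
rewrite leNgt; apply/negP => lt0.
set y := x + _ in lt0 *.
(* For this [k], the distances of [picard k.+1 t] to [phi t] and to [y] add up to at most half the
   distance from [phi t] to [y], which is absurd if the latter is positive. *)
have [||k hk] := small (enorm (phi t - y) / 2) (n%:R * 2).
- by rewrite divr_gt0.
- by rewrite mulr_ge0.
have h1 : enorm (picard k.+1 t - phi t) <= 2^-1 * (n%:R * (2 * 2^-1 ^+ k)).
  by have := phi_elim t k.+1 tab; rewrite exprS; lra.
have h2 : enorm (picard k.+1 t - y) <= 2^-1 * (n%:R * (2 * 2^-1 ^+ k)).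
  rewrite /= /y opprD addrACA subrr add0r.
  apply: (vintegral_contract (picard_admissible k) aphi) => //.
  by move=> s sab; exact: phi_elim.
have := enorm_dist_triangle (picard k.+1 t) (phi t) y.
rewrite (enorm_distC (phi t) (picard k.+1 t)).
lra.
Qed.

End Picard.

(** * One-step estimates for the exact model *)

Section ExactModel.
Context {R : realType} {n m p : nat}.
Variable f : 'rV[R]_n -> 'rV[R]_m -> 'rV[R]_p -> 'rV[R]_n.

Lemma sampling_interval_ge0 T k : 0 < T ->
  @sampling_interval R T k `<=` nonneg_reals.
Proof.
move=> T0 t; rewrite /sampling_interval /nonneg_reals /= !in_itv /= andbT.
move=> /andP[h _].
by apply: le_trans h; rewrite mulr_ge0// ltW.
Qed.

Lemma wsegE (w : R -> 'rV[R]_p) T k t :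
  sampling_interval T k t -> (wseg w T k).2 t = w t.
Proof. by move=> h; rewrite /wseg/= /patch mem_set. Qed.

Lemma Lmeasurable_sub (w : R -> 'rV[R]_p) (D : set R) i :
  @measurable _ (lebesgueType R) D -> D `<=` nonneg_reals ->
  Lmeasurable w -> @measurable_fun _ _ (lebesgueType R) (measurableTypeR R) D
    (fun t => w t 0 i).
Proof.
move=> mD DS mw.
apply: (@measurable_funS _ _ (lebesgueType R) (measurableTypeR R) nonneg_reals) => //.
exact: measurable_itv_leb.
Qed.

(** The radius [r + 1] covers the unit ball around every initial state considered; there [f] is
    bounded by [C] and Lipschitz with constant [L]. The condition [T K <= 1/2] implies the smallness
    conditions of Picard iteration and of the a priori bound. *)
Lemma exact_model_one_step r : locally_lipschitz f -> f 0 0 0 = 0 -> 0 < r ->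
  exists2 K, 0 < K & forall T k (w : R -> 'rV[R]_p) x, 0 < T -> T * K <= 2^-1 ->
    Lmeasurable w ->
    (forall t, sampling_interval T k t -> enorm (w t) <= r) -> enorm x <= r ->
  [/\ forall u, enorm u <= r -> exists y, exact_model f T x u (wseg w T k) y,
      forall u y, enorm u <= r -> exact_model f T x u (wseg w T k) y ->
        enorm (y - x) <= K * T &
      forall u1 u2 y1 y2, enorm u1 <= r -> enorm u2 <= r ->
        exact_model f T x u1 (wseg w T k) y1 ->
        exact_model f T x u2 (wseg w T k) y2 ->
        enorm (y1 - y2) <= K * T * (T + enorm (u1 - u2))].
Proof.
move=> f_lip f0 r0.
have [L L0 HL] := locally_lipschitz_bounded (r + 1) f_lip.
(* Lipschitz bound against [f 0 0 0 = 0], with three arguments of norm at most [r + 1]. *)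
pose C := L * (3 * (r + 1)).
have C0 : 0 < C by apply: mulr_gt0 => //; lra.
pose N : R := n.+1%:R.
have N1 : 1 <= N by rewrite ler1n.
have nN : n%:R <= N by rewrite ler_nat.
have N0 : 0 < N by rewrite ltr0n.
(* The summand [N C] serves the displacement, the other one the comparison of two inputs. Taking
   [N = n + 1] keeps both positive when [n = 0]. *)
pose K := N * L * (2 * (N * C) + 1) + N * C.
have NC0 : 0 < N * C by rewrite mulr_gt0.
have NL0 : 0 < N * L by rewrite mulr_gt0.
have P0 : 0 < 2 * (N * C) + 1 by lra.
exists K; first exact: (addr_gt0 (mulr_gt0 NL0 P0) NC0).
move=> T k w x T0 TK mw wr xr.
pose a : R := k%:R * T; pose b : R := k.+1%:R * T.
have baT : b - a = T by rewrite /a /b -mulrBl -natrB// subSnn mul1r.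
have ab : a <= b by rewrite -subr_ge0 baT ltW.
have NCK : N * C <= K by rewrite /K lerDr ltW// mulr_gt0.
have NLK : N * L <= K.
  rewrite /K (_ : N * L * _ = N * L + N * L * (2 * (N * C))); last by ring.
  by rewrite -addrA lerDl ltW// addr_gt0// mulr_gt0// mulr_gt0.
pose v := (wseg w T k).2.
have vr t : a <= t <= b -> enorm (v t) <= r.
  move=> tab; have tS : sampling_interval T k t by rewrite /sampling_interval/= in_itv.
  by rewrite /v wsegE// wr.
have f_le u t y : enorm u <= r -> a <= t <= b -> enorm (y - x) <= 1 ->
    enorm (f y u (v t)) <= C.
  move=> ur tab yx; have vt := vr t tab.
  have yr : enorm y <= r + 1 by have := enorm_le_dist y x; lra.
  have := HL y 0 u 0 (v t) 0; rewrite f0 !subr0 !enorm0 => H.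
  have r1 : 0 <= r + 1 by lra.
  have ur1 : enorm u <= r + 1 by lra.
  have vr1 : enorm (v t) <= r + 1 by lra.
  apply: (le_trans (H yr r1 ur1 r1 vr1 r1)).
  by rewrite /C ler_pM2l//; lra.
have f_lipL u1 u2 t y1 y2 : enorm u1 <= r -> enorm u2 <= r -> a <= t <= b ->
    enorm (y1 - x) <= 1 -> enorm (y2 - x) <= 1 ->
    enorm (f y1 u1 (v t) - f y2 u2 (v t)) <= L * (enorm (y1 - y2) + enorm (u1 - u2)).
  move=> u1r u2r tab y1x y2x; have vt := vr t tab.
  have y1r : enorm y1 <= r + 1 by have := enorm_le_dist y1 x; lra.
  have y2r : enorm y2 <= r + 1 by have := enorm_le_dist y2 x; lra.
  have := HL y1 y2 u1 u2 (v t) (v t); rewrite subrr enorm0 addr0.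
  have ltr1 : r <= r + 1 by rewrite lerDl.
  by apply => //; exact: le_trans ltr1.
have CT : n%:R * (C * (b - a)) <= 2^-1.
  rewrite baT; apply: le_trans TK; rewrite mulrA (mulrC T) ler_pM2r//.
  by apply: le_trans NCK; rewrite ler_pM2r.
have LT : n%:R * (L * (b - a)) <= 2^-1.
  rewrite baT; apply: le_trans TK; rewrite mulrA (mulrC T) ler_pM2r//.
  by apply: le_trans NLK; rewrite ler_pM2r.
have mv i : @measurable_fun _ _ (lebesgueType R) (measurableTypeR R)
  `[a, b] (fun t => v t 0 i).
  apply: (@eq_measurable_fun _ _ (lebesgueType R) (measurableTypeR R) _ (fun t => w t 0 i)).
    by move=> t /set_mem tab; rewrite /v wsegE.
  apply: Lmeasurable_sub => //; first exact: measurable_itv_leb.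
  exact: sampling_interval_ge0.
have model_bound u y : enorm u <= r -> exact_model f T x u (wseg w T k) y ->
    exists phi, [/\ plant_solution f a b x u v phi, y = phi b &
      forall t, a <= t <= b -> enorm (phi t - x) <= n%:R * (C * T)].
  move=> ur [phi sphi ->]; exists phi; split => //.
    by case: sphi => _ -> //=; rewrite ab lexx.
  rewrite -baT => t tab.
  apply: (plant_solution_bound (ltW C0) _ CT sphi tab).
  by move=> s z; exact: f_le.
have CT1 : n%:R * (C * T) <= N * C * T by rewrite mulrA ler_pM2r// ler_pM2r.
split.
- move=> u ur.
  have [|phi sphi] := @plant_solution_exists R n m p f a b C L x u v f_lip ab
    (ltW C0) (ltW L0) (fun t y => f_le u t y ur) _ CT LT mv.
    move=> t y1 y2 tab h1 h2; have := f_lipL u u t y1 y2 ur ur tab h1 h2.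
    by rewrite subrr enorm0 addr0.
  by exists (x + vintegral `[a, b] (fun s => f (phi s) u (v s))); exists phi.
- move=> u y ur /(model_bound _ _ ur)[phi [_ -> h]].
  have := h b; rewrite ab lexx => /(_ isT) hb; rewrite (le_trans hb)//.
  by rewrite (le_trans CT1)// ler_pM2r.
move=> u1 u2 y1 y2 u1r u2r.
move=> /(model_bound _ _ u1r)[phi1 [[ig1 e1] -> h1]].
move=> /(model_bound _ _ u2r)[phi2 [[ig2 e2] -> h2]].
have bab : a <= b <= b by rewrite ab lexx.
rewrite e1// e2// opprD addrACA subrr add0r.
have small t phi : a <= t <= b -> (forall t, a <= t <= b ->
    enorm (phi t - x) <= n%:R * (C * T)) -> enorm (phi t - x) <= 1.
  move=> tab h; apply: (le_trans (h t tab)); rewrite -baT; lra.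
have e0 := enorm_ge0 (u1 - u2).
(* Each solution is within [N C T] of the common initial state [x], so they are at most [2 N C T]
   apart. *)
apply: (@le_trans _ _ (n%:R * (L * (2 * (N * C * T) + enorm (u1 - u2)) * (b - a)))).
  apply: enorm_le_card => i; rewrite !mxE.
  rewrite -(@RintegralB _ (lebesgueType R) R leb _ _ _
    (measurable_itv_leb `[a, b]) (ig1 i) (ig2 i)).
  apply: Rintegral_leb_norm_le => //.
    exact: (@integrableB _ (lebesgueType R) R leb _ (measurable_itv_leb `[a, b]) _ _ (ig1 i) (ig2 i)).
  move=> s /andP[as_ sb]; have sab : a <= s <= b by rewrite as_ ltW.
  have -> : f (phi1 s) u1 (v s) 0 i - f (phi2 s) u2 (v s) 0 i =
    (f (phi1 s) u1 (v s) - f (phi2 s) u2 (v s)) 0 i by rewrite !mxE.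
  rewrite (le_trans (normr_coord_le_enorm _ _))//.
  apply: (le_trans (f_lipL _ _ _ _ _ u1r u2r sab _ _)).
  - exact: small h1.
  - exact: small h2.
  rewrite ler_pM2l// lerD2r.
  have := enorm_dist_triangle x (phi1 s) (phi2 s).
  have := h1 s sab; have := h2 s sab; rewrite (enorm_distC x); lra.
rewrite baT.
set S := 2 * _ + _.
have NCT0 : 0 <= N * C * T by rewrite mulr_ge0// ltW.
have S0 : 0 <= S by rewrite /S; lra.
apply: (@le_trans _ _ (N * L * T * S)).
  rewrite (_ : n%:R * _ = n%:R * (L * T * S)); last by ring.
  rewrite (_ : N * _ * _ * _ = N * (L * T * S)); last by ring.
  by rewrite ler_wpM2r// mulr_ge0// mulr_ge0// ltW.
apply: (@le_trans _ _ (N * L * T * ((2 * (N * C) + 1) * (T + enorm (u1 - u2))))).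
  rewrite ler_pM2l ?mulr_gt0// /S.
  rewrite (_ : _ * (T + _) = 2 * (N * C * T) + enorm (u1 - u2) +
    (2 * (N * C) * enorm (u1 - u2) + T)); last by ring.
  rewrite lerDl addr_ge0//; last exact: ltW.
  by rewrite mulr_ge0// mulr_ge0// ltW.
rewrite (_ : N * L * T * _ =
  (N * L * (2 * (N * C) + 1)) * (T * (T + enorm (u1 - u2)))); last by ring.
rewrite -[leRHS]mulrA ler_wpM2r//; last by rewrite /K lerDl ltW.
by rewrite mulr_ge0// ?addr_ge0//; exact: ltW.
Qed.

End ExactModel.

(** * Comparison functions and disturbances *)

Section ComparisonFunctions.
Context {R : realType}.

Lemma classK0 (g : R -> R) : classK g -> g 0 = 0.
Proof. by case=> -[]. Qed.

Lemma classK_le (g : R -> R) s t : classK g -> 0 <= s -> s <= t -> g s <= g t.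
Proof.
move=> [_ inc] s0; rewrite le_eqVlt => /predU1P[->//|st]; exact/ltW/inc.
Qed.

Lemma classK_ge0 (g : R -> R) s : classK g -> 0 <= s -> 0 <= g s.
Proof. by move=> gK s0; rewrite -(classK0 gK) classK_le. Qed.

Lemma classKoo_large (g : R -> R) A : classKoo g ->
  exists2 r, 0 < r & forall s, r <= s -> A < g s.
Proof.
move=> [_ /cvgryPgt /(_ A) [r [_ H]]]; exists (Num.max r 0 + 1).
  by rewrite ltr_wpDl// le_max lexx orbT.
by move=> s rs; apply: H; apply: lt_le_trans rs; rewrite ltr_pwDr// le_max lexx.
Qed.

Lemma classK_continuous (g : R -> R) s e : classK g -> 0 <= s -> 0 < e ->
  exists2 d, 0 < d & forall t, 0 <= t -> `|t - s| < d -> `|g t - g s| < e.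
Proof.
move=> [[/subspace_continuousP cg _ _] _] s0 e0.
have /cvgrPdist_lt /(_ e e0) : g x @[x --> within nonneg_reals (nbhs s)] --> g s.
  by apply: cg; rewrite /nonneg_reals/= in_itv/= s0.
rewrite near_withinE => -[d /= d0 H]; exists d => // t t0 ts.
rewrite distrC; apply: H; first by rewrite /ball/= distrC.
by rewrite /nonneg_reals/= in_itv/= t0.
Qed.

(** Continuity of [g] is given only within the nonnegative reals, where norms lie. *)
Lemma continuous_classK_enorm N (g : R -> R) : classK g ->
  continuous (fun z : 'rV[R]_N => g (enorm z)).
Proof.
move=> gK; apply: continuous_enorm_eps => z0 e e0.
have [d d0 H] := classK_continuous gK (enorm_ge0 z0) e0.
exists d => // z zd; apply: H; first exact: enorm_ge0.
apply: le_lt_trans zd; rewrite ler_norml.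
have := enorm_le_dist z z0; have := enorm_le_dist z0 z.
by rewrite (enorm_distC z0) => h1 h2; apply/andP; split; lra.
Qed.

End ComparisonFunctions.

Section DisturbanceEnergy.
Context {R : realType} {p : nat}.
Implicit Types (w : R -> 'rV[R]_p).

Lemma supnorm_ltP (D : set R) w r t :
  (supnorm D w < r%:E)%E -> D t -> enorm (w t) < r.
Proof.
move=> h Dt; rewrite -lte_fin; apply: le_lt_trans h.
by apply: ereal_sup_ubound; exists t.
Qed.

Lemma supnorm_leP (D : set R) w r :
  (forall t, D t -> enorm (w t) <= r) -> (supnorm D w <= r%:E)%E.
Proof.
by move=> h; apply: ge_ereal_sup => _ [t Dt <-]; rewrite lee_fin h.
Qed.

Lemma integrable_classK_enorm (g : R -> R) w r a b : classK g -> 0 <= a ->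
  Lmeasurable w -> (forall t, 0 <= t -> enorm (w t) <= r) ->
  leb.-integrable `[a, b] (fun s => (g (enorm (w s)))%:E).
Proof.
move=> gK a0 mw wr; apply: (@integrable_leb_bounded R _ a b (g r)).
  apply: (@measurable_comp_rV R _ (lebesgueType R) p `[a, b]%classic w
    (fun z => g (enorm z))); last exact: continuous_classK_enorm.
  move=> i; apply: Lmeasurable_sub => //; first exact: measurable_itv_leb.
  move=> t; rewrite /nonneg_reals/= !in_itv/= andbT => /andP[at_ _].
  exact: le_trans at_.
move=> t /andP[at_ _]; have t0 := le_trans a0 at_.
by rewrite ger0_norm ?(classK_ge0 gK) ?enorm_ge0// (classK_le gK) ?enorm_ge0// wr.
Qed.

Lemma Rintegral_leb_chasles (g : R -> R) a s t : a <= s -> s <= t ->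
  leb.-integrable `[a, t] (fun x => (g x)%:E) ->
  \int[leb]_(x in `[a, t]) g x =
  \int[leb]_(x in `[a, s]) g x + \int[leb]_(x in `[s, t]) g x.
Proof.
move=> as_ st ig; rewrite (Rintegral_leb_split as_ st ig); congr (_ + _).
rewrite (Rintegral_leb_split (lexx s) st).
  by rewrite set_itv1 Rintegral_leb_set1 add0r.
apply: (@integrableS _ (lebesgueType R) R leb `[a, t]%classic); last exact: ig.
- exact: measurable_itv_leb.
- exact: measurable_itv_leb.
- by apply: subset_itvr; rewrite bnd_simp.
Qed.

(** Gives a bounded disturbance finite energy without changing its segment on the period [k]. *)
Definition truncation w (T : R) k := patch (fun=> 0) (sampling_interval T k) w.

Lemma wseg_truncation w T k : wseg (truncation w T k) T k = wseg w T k.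
Proof.
congr pair; apply/funext => t; rewrite /truncation /patch.
by case: ifP => // ->.
Qed.

Lemma Linfty_lt_truncation w T k r : 0 < T -> Linfty_lt r w ->
  Linfty_lt r (truncation w T k).
Proof.
move=> T0 [mw supw]; split.
  move=> i.
  have mS := measurable_itv_leb `[k%:R * T, k.+1%:R * T].
  have mN := @measurable_itv_leb R `[0, +oo[.
  rewrite (_ : (fun t => _) = (fun t => w t 0 i) \_ (sampling_interval T k)).
    apply/(measurable_restrict _ mS mN).
    apply: Lmeasurable_sub.
    - exact: (@measurableI _ (lebesgueType R)).
    - by move=> t [].
    - by [].
  by apply/funext => t; rewrite /truncation /patch; case: ifP; rewrite ?mxE.
apply: le_lt_trans supw; apply: ge_ereal_sup => _ [t Dt <-].
apply: (@le_trans _ _ (enorm (w t))%:E).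
  rewrite lee_fin /truncation /patch; case: ifP => // _.
  by rewrite enorm0 enorm_ge0.
by apply: ereal_sup_ubound; exists t.
Qed.

Lemma Rintegral_sampling_le (g : R -> R) w T k r : classK g -> 0 < T ->
  Lmeasurable w -> (forall t, 0 <= t -> enorm (w t) <= r) ->
  \int[leb]_(s in sampling_interval T k) g (enorm (w s)) <= T * g r.
Proof.
move=> gK T0 mw wr; rewrite (le_trans (ler_norm _))//.
have kT : 0 <= k%:R * T by rewrite mulr_ge0// ltW.
have -> : T * g r = g r * (k.+1%:R * T - k%:R * T).
  by rewrite -mulrBl -natrB// subSnn mul1r mulrC.
apply: Rintegral_leb_norm_le.
- by rewrite ler_pM2r// ler_nat.
- exact: (integrable_classK_enorm _ gK kT mw wr).
move=> s /andP[ks _]; have s0 := le_trans kT ks.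
by rewrite ger0_norm ?(classK_ge0 gK) ?enorm_ge0// (classK_le gK) ?enorm_ge0// wr.
Qed.

(** Since [g 0 = 0], only the period [k] contributes to the energy, and its contribution is at most
    [T * g r]. *)
Lemma Lgamma_lt_truncation (g : R -> R) w T k r C : classK g -> 0 < T ->
  Linfty_lt r w -> T * g r < C -> Lgamma_lt g C (truncation w T k).
Proof.
move=> gK T0 wr TC; split; first by case: (Linfty_lt_truncation k T0 wr).
case: wr => mw supw.
have w_le t : 0 <= t -> enorm (w t) <= r.
  move=> t0; apply/ltW/(supnorm_ltP supw).
  by rewrite /nonneg_reals/= in_itv/= t0.
have kT : 0 <= k%:R * T by rewrite mulr_ge0// ltW.
have ig := integrable_classK_enorm (k.+1%:R * T) gK kT mw w_le.
have -> : Defs.gnorm g (truncation w T k) =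
    (\int[leb]_(s in sampling_interval T k) (g (enorm (w s)))%:E)%E.
  transitivity (\int[leb]_(s in nonneg_reals)
    ((fun s : R => (g (enorm (w s)))%:E) \_ (sampling_interval T k)) s)%E.
    apply: eq_integral => t _; rewrite /truncation /patch; case: ifP => // _.
    by rewrite enorm0 (classK0 gK).
  by rewrite -integral_mkcondr setIidr//; exact: sampling_interval_ge0.
apply: (@le_lt_trans _ _ (\int[leb]_(s in sampling_interval T k) g (enorm (w s)))%:E).
  rewrite /Rintegral fineK//.
  by apply: (integrable_fin_num _ ig); exact: measurable_itv_leb.
rewrite lte_fin; apply: le_lt_trans TC.
exact: Rintegral_sampling_le.
Qed.

End DisturbanceEnergy.

(** * Closed loop *)

Section ClosedLoop.
Context {R : realType} {n m p : nat}.
Variables (f : 'rV[R]_n -> 'rV[R]_m -> 'rV[R]_p -> 'rV[R]_n) (l : nat)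
  (Fa : approx_model R n m p) (uc : control_family R n m) (T h : R)
  (w : R -> 'rV[R]_p) (V : 'rV[R]_n -> R) (alow aup alpha : R -> R)
  (energy : nat -> R).
(* [D] bounds the states, [c] the Lyapunov function, [g] the supply rate;
   [K], [Lu], [M], [eps] are the constants of the exact one-step model, of the
   control law, of the Lyapunov function and of consistency. *)
Variables (D U r c d g K E Lu M eps : R).
Hypothesis EK : E = 2 * K + 1.
Local Notation z0 := (fun=> 0 : 'rV[R]_p).
Hypothesis l0 : (0 < l)%N.
Hypothesis T0 : 0 < T.
Hypothesis T1 : T <= 1.
Hypothesis K0 : 0 < K.
Hypothesis TK : T * K <= 2^-1.
Hypothesis TE : l%:R * (T * E) <= 1.
Hypothesis D0 : 0 < D.
Hypothesis M0 : 0 < M.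
Hypothesis Lu0 : 0 < Lu.
Hypothesis eps1 : eps <= 1.
Hypothesis smallT : M * (K * (T + Lu * (l%:R * (T * E)))) <= d / 4.
Hypothesis smallh : M * eps <= d / 4.
Hypothesis d0 : 0 < d.
Hypothesis g0 : 0 <= g.
Hypothesis UE : U = Lu * (D + 3).
Hypothesis alpha_ge0 : forall s, 0 <= s -> 0 <= alpha s.
Hypothesis aup_mono : forall s t, 0 <= s -> s <= t -> aup s <= aup t.
Hypothesis alpha_r : forall s, r <= s -> g + d < alpha s.
Hypothesis alow_D : forall s, D <= s -> c < alow s.
Hypothesis c_r : aup r + g + d <= c.
Hypothesis energy_le : forall k, energy k <= T * g.

Hypothesis exact_ex : forall v k x u, v = w \/ v = z0 ->
  enorm x <= D + 3 -> enorm u <= U -> exists y, exact_model f T x u (wseg v T k) y.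
Hypothesis exact_move : forall v k x u y, v = w \/ v = z0 ->
  enorm x <= D + 3 -> enorm u <= U -> exact_model f T x u (wseg v T k) y ->
  enorm (y - x) <= K * T.
Hypothesis exact_lip : forall k x u1 u2 y1 y2,
  enorm x <= D + 3 -> enorm u1 <= U -> enorm u2 <= U ->
  exact_model f T x u1 (wseg w T k) y1 -> exact_model f T x u2 (wseg w T k) y2 ->
  enorm (y1 - y2) <= K * T * (T + enorm (u1 - u2)).
Hypothesis consist : forall v k x u y, v = w \/ v = z0 ->
  enorm x <= D + 3 -> enorm u <= U -> exact_model f T x u (wseg v T k) y ->
  enorm (y - Fa T h x u (wseg v T k)) <= T * eps.
Hypothesis uc_lip : forall x1 x2, enorm x1 <= D + 3 -> enorm x2 <= D + 3 ->
  enorm (uc T h x2 - uc T h x1) <= Lu * enorm (x2 - x1).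
Hypothesis uc0 : uc T h 0 = 0.
Hypothesis V_bounds : forall x, enorm x <= D + 3 ->
  alow (enorm x) <= V x <= aup (enorm x).
Hypothesis V_decr : forall k x, enorm x <= D + 3 ->
  V (Fa T h x (uc T h x) (wseg w T k)) - V x <=
  T * (- alpha (enorm x) + T^-1 * energy k + d / 2).
Hypothesis V_lip : forall x1 x2, enorm x1 <= D + 3 -> enorm x2 <= D + 3 ->
  `|V x1 - V x2| <= M * enorm (x1 - x2).

(** The remainder [k %% l] counts the periods since the last measurement. During each, the plant
    moves by at most [K T] and the prediction by at most [K T + T eps <= (K + 1) T], whence
    [E = 2 K + 1]. *)
Definition loop_invariant k (x xc : 'rV[R]_n) :=
  [/\ enorm x <= D, V x <= c & enorm (xc - x) <= (k %% l)%N%:R * (T * E)].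

(* [lra] ignores section hypotheses. *)
Local Ltac loop_lra :=
  have := D0; have := T0; have := TK; have := TE; have := eps1; have := smallT;
  have := smallh; have := d0; have := g0; have := c_r; lra.

Lemma substep_gt0 : 0 < E. Proof. by rewrite EK addr_gt0// mulr_gt0. Qed.

Lemma loop_control_le x : enorm x <= D + 3 -> enorm (uc T h x) <= U.
Proof.
move=> xD; have := @uc_lip 0 x _ xD; rewrite uc0 !subr0 enorm0 => H.
have D3 : 0 <= D + 3 by loop_lra.
by rewrite UE (le_trans (H D3))// ler_pM2l.
Qed.

Lemma controller_dist k x xc : loop_invariant k x xc ->
  enorm (xc - x) <= l%:R * (T * E) /\ enorm xc <= D + 1.
Proof.
move=> [xD _ xcx].
have H : enorm (xc - x) <= l%:R * (T * E).
  have E0 := substep_gt0; rewrite (le_trans xcx)// ler_pM2r ?mulr_gt0// ler_nat ltnW// ltn_mod //.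
split=> //; have := enorm_le_dist xc x; loop_lra.
Qed.

Lemma loop_step_exists k x xc : loop_invariant k x xc ->
  exists y, exact_model f T x (uc T h xc) (wseg w T k) y.
Proof.
move=> inv; have [_ xcD] := controller_dist inv; have [xD _ _] := inv.
apply: exact_ex; [by left|loop_lra|apply: loop_control_le; loop_lra].
Qed.

(** The exact step [y] with input [u(x)] is interposed between the actual step [x'] and the
    approximate step [fa]. The gap from [x'] to [y] costs [T d / 4] by [smallT], that from [y] to
    [fa] costs [T d / 4] by [smallh], and [V_decr] already carries [T d / 2]. *)
Lemma loop_step_lyapunov k x xc x' : loop_invariant k x xc ->
  exact_model f T x (uc T h xc) (wseg w T k) x' ->
  V x' - V x <= - (T * alpha (enorm x)) + energy k + T * d.
Proof.
move=> inv ex'; have [xcx xcD] := controller_dist inv; have [xD _ _] := inv.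
have xD3 : enorm x <= D + 3 by loop_lra.
have xcD3 : enorm xc <= D + 3 by loop_lra.
have uxc := loop_control_le xcD3; have ux := loop_control_le xD3.
have [y ey] := exact_ex k (or_introl erefl) xD3 ux.
set fa := Fa T h x (uc T h x) (wseg w T k).
have yfa : enorm (y - fa) <= T * eps by apply: consist ey => //; left.
have yx : enorm (y - x) <= K * T by apply: exact_move ey => //; left.
have x'x : enorm (x' - x) <= K * T by apply: exact_move ex' => //; left.
have x'y := exact_lip xD3 uxc ux ex' ey.
have Teps : T * eps <= 1.
  by apply: (@le_trans _ _ (T * 1)); [rewrite ler_pM2l|rewrite mulr1].
(* The margin in [D + 3] leaves room for an exact step, of length at most [1/2], and for the
   consistency error, at most [1]. *)
have x'D3 : enorm x' <= D + 3 by have := enorm_le_dist x' x; loop_lra.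
have faD3 : enorm fa <= D + 3.
  have := enorm_le_dist fa y; have := enorm_le_dist y x.
  by rewrite (enorm_distC fa); loop_lra.
have x'fa : enorm (x' - fa) <= K * T * (T + Lu * (l%:R * (T * E))) + T * eps.
  apply: (le_trans (enorm_dist_triangle y _ _)); rewrite lerD//.
  apply: (le_trans x'y); rewrite ler_pM2l ?mulr_gt0// lerD2l.
  by apply: (le_trans (uc_lip xD3 xcD3)); rewrite ler_pM2l.
have Vx'fa : V x' - V fa <= T * (d / 2).
  rewrite (le_trans (ler_norm _))// (le_trans (V_lip x'D3 faD3))//.
  apply: (@le_trans _ _ (M * (K * T * (T + Lu * (l%:R * (T * E))) + T * eps))).
    by rewrite ler_pM2l.
  rewrite (_ : M * _ = T * (M * (K * (T + Lu * (l%:R * (T * E)))) + M * eps)); last by ring.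
  by rewrite ler_pM2l//; loop_lra.
have := V_decr k xD3; rewrite -/fa !mulrDr mulVKf ?gt_eqF//.
rewrite mulrN; loop_lra.
Qed.

Lemma loop_step_invariant k x xc x' : loop_invariant k x xc ->
  exact_model f T x (uc T h xc) (wseg w T k) x' ->
  loop_invariant k.+1 x' (if (l %| k.+1)%N then x' else
    Fa T h xc (uc T h xc) (wseg z0 T k)).
Proof.
move=> inv ex'; have [xcx xcD] := controller_dist inv; have [xD Vx dx] := inv.
have xD3 : enorm x <= D + 3 by loop_lra.
have xcD3 : enorm xc <= D + 3 by loop_lra.
have uxc := loop_control_le xcD3.
have x'x : enorm (x' - x) <= K * T by apply: exact_move ex' => //; left.
have x'D3 : enorm x' <= D + 3 by have := enorm_le_dist x' x; loop_lra.
have Vx' := loop_step_lyapunov inv ex'.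
have ek := energy_le k.
have Vx'c : V x' <= c.
  (* Outside the ball of radius [r] the decay beats the supply [g + d], so [V] does not increase;
     inside, [V x <= aup r] and the growth is at most [g + d] since [T <= 1], so [c] is not
     exceeded. *)
  have [rx|xr] := leP r (enorm x).
    have : T * (g + d) <= T * alpha (enorm x) by rewrite ler_pM2l// ltW// alpha_r.
    loop_lra.
  have := V_bounds xD3 => /andP[_ ].
  have := aup_mono (enorm_ge0 x) (ltW xr).
  have : 0 <= T * alpha (enorm x) by rewrite mulr_ge0// ?(ltW T0)// alpha_ge0// enorm_ge0.
  have : T * (g + d) <= 1 * (g + d) by rewrite ler_wpM2r//; loop_lra.
  loop_lra.
split=> //.
  rewrite leNgt; apply/negP => /ltW /alow_D.
  have /andP[+ _] := V_bounds x'D3; loop_lra.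
(* A measurement resets the error to zero; otherwise the remainder modulo [l] increases by one
   without wrapping around. *)
case: ifPn => lk.
  by rewrite subrr enorm0 mulr_ge0// mulr_ge0// ltW// substep_gt0.
have -> : (k.+1 %% l = (k %% l).+1)%N.
  by rewrite modnS (negbTE lk).
(* The controller predicts with zero disturbance; the exact undisturbed step from [xc] controls how
   far the prediction moves. *)
have [y ey] := exact_ex k (or_intror erefl) xcD3 uxc.
have yxc : enorm (y - xc) <= K * T by apply: exact_move ey => //; right.
have yfa : enorm (y - Fa T h xc (uc T h xc) (wseg z0 T k)) <= T * eps.
  by apply: consist ey => //; right.
have Teps : T * eps <= T * 1 by rewrite ler_pM2l.
set fa := Fa _ _ _ _ _ in yfa *.
have := enorm_dist_triangle y fa x'; rewrite (enorm_distC fa y).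
have := enorm_dist_triangle xc y x'.
have := enorm_dist_triangle x xc x'; rewrite (enorm_distC x x').
have -> : (k %% l).+1%:R * (T * E) = (k %% l)%:R * (T * E) + T * E :> R.
  by rewrite -natr1 mulrDl mul1r.
have -> : T * E = K * T + K * T + T * 1 by rewrite EK; ring.
have := dx; rewrite EK.
have -> : T * (2 * K + 1) = K * T + K * T + T * 1 by ring.
loop_lra.
Qed.

Lemma loop_invariant_solution x : V (x 0%N) <= c -> enorm (x 0%N) <= D ->
  dual_rate_exact f Fa uc l T h w x ->
  forall k, loop_invariant k (x k) (controller_state Fa uc l T h x k).
Proof.
move=> Vc xD sol; elim=> [|k ih].
  by split=> //=; rewrite dvdn0 subrr enorm0 mod0n mul0r.
exact: loop_step_invariant ih (sol k).
Qed.

(** Plant and controller states are built together, as each plant step needs the current controller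
    state. The default [0] of [xget] is never taken: the invariant, proved along the construction,
    guarantees a next state. *)
Lemma dual_rate_exact_exists x0 : V x0 <= c -> enorm x0 <= D ->
  exists x, x 0%N = x0 /\ dual_rate_exact f Fa uc l T h w x.
Proof.
move=> Vc xD.
pose next k (s : 'rV[R]_n * 'rV[R]_n) :=
  let y := xget 0 [set y | exact_model f T s.1 (uc T h s.2) (wseg w T k) y] in
  (y, if (l %| k.+1)%N then y else Fa T h s.2 (uc T h s.2) (wseg z0 T k)).
pose s := fix s k := if k is j.+1 then next j (s j) else (x0, x0).
have sE k (inv : loop_invariant k (s k).1 (s k).2) :
    exact_model f T (s k).1 (uc T h (s k).2) (wseg w T k) (s k.+1).1.
  exact: (xgetPex 0 (loop_step_exists inv)).
have sinv k : loop_invariant k (s k).1 (s k).2.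
  elim: k => [|k ih]; last exact: loop_step_invariant ih (sE k ih).
  by split=> //=; rewrite subrr enorm0 mod0n mul0r.
exists (fun k => (s k).1); split => // k.
have -> : controller_state Fa uc l T h (fun k => (s k).1) k = (s k).2.
  elim: k => [|k ih]; first by rewrite /= dvdn0.
  by rewrite /= ih.
exact: sE.
Qed.

(** Telescoping of the one-step Lyapunov estimate, valid at every step by the invariant. *)
Lemma loop_dissipation x : V (x 0%N) <= c -> enorm (x 0%N) <= D ->
  dual_rate_exact f Fa uc l T h w x -> forall k,
  T * \sum_(i < k) alpha (enorm (x i)) <=
  V (x 0%N) - V (x k) + \sum_(i < k) energy i + T * k%:R * d.
Proof.
move=> Vc xD sol; have inv := loop_invariant_solution Vc xD sol.
elim=> [|k ih]; first by rewrite !big_ord0 subrr !mulr0 mul0r !addr0.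
rewrite !big_ord_recr /= -natr1.
have := loop_step_lyapunov (inv k) (sol k); loop_lra.
Qed.

End ClosedLoop.

(** * Choice of the constants and conclusion *)

Theorem theorem8 (R : realType) (n m p : nat)
    (f : 'rV[R]_n -> 'rV[R]_m -> 'rV[R]_p -> 'rV[R]_n)
    (l : nat)
    (Fa : approx_model R n m p)
    (uc : control_family R n m)
    (f_lipschitz : locally_lipschitz f)
    (f0 : f 0 0 0 = 0)
    (l_ge1 : (1 <= l)%N)
    (uc0 : forall T h : R, 0 < T -> 0 < h -> uc T h 0 = 0)
    (lyapunov : lyapunov_SP_iIiSS (single_rate_approx Fa uc))
    (consistent : one_step_consistent f Fa)
    (uc_lipschitz : uniformly_locally_lipschitz uc) :
  SP_iIiSS (dual_rate_exact f Fa uc l).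
Proof.
have [alow [aup [alpha [ghat [alowK [aupK [alphaK [ghatK lyap]]]]]]]] := lyapunov.
(* The function [aup] serves as [chi] because [V x0 <= aup (enorm x0)]. *)
exists alpha, aup, ghat; split => //; split => //; split => //.
move=> Dx Dw d Dx0 Dw0 d0.
set g := ghat Dw.
have g0 : 0 <= g by apply: classK_ge0 => //; exact: ltW.
have [r r0 alpha_r] := classKoo_large (g + d) alphaK.
(* This level lies above [V] at every initial state, by [aup Dx], and above whatever one step can
   reach from the ball of radius [r]. *)
pose c := aup Dx + aup r + g + d.
have aupDx0 : 0 <= aup Dx by apply: classK_ge0 (ltW Dx0); case: aupK.
have aupr0 : 0 <= aup r by apply: classK_ge0 (ltW r0); case: aupK.
have [D' D'0 alow_D'] := classKoo_large c alowK.
(* [D'] bounds the sublevel set of [c] through [alow]; [Dx] is added to include the initial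
   states. *)
pose D := D' + Dx.
have D0 : 0 < D by rewrite addr_gt0.
have D30 : 0 < D + 3 by rewrite addr_gt0.
have g10 : 0 < g + 1 by rewrite ltr_wpDl.
have d20 : 0 < d / 2 by rewrite divr_gt0.
(* The energy bound [g + 1] strictly exceeds that of a truncation to one period, at most [T g <= g];
   asking for [d / 2] leaves [d / 2] for the model and control errors. *)
have [TL [M [TL0 [M0 lyapT]]]] := lyap (D + 3) Dw (g + 1) (d / 2) D30 Dw0 g10 d20.
have [Tu [Lu [Tu0 [Lu0 ulip]]]] := uc_lipschitz (D + 3) D30.
pose U := Lu * (D + 3).
have U0 : 0 < U by rewrite mulr_gt0.
pose rad := D + 3 + U + Dw.
have rad0 : 0 < rad by rewrite !addr_gt0.
have [K K0 step] := exact_model_one_step f_lipschitz f0 rad0.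
have [rho [Tc [rhoK [Tc0 cons]]]] := consistent rad rad rad.
pose E := 2 * K + 1.
have E0 : 0 < E by rewrite /E addr_gt0// mulr_gt0.
have l0 : 0 < l%:R :> R by rewrite ltr0n.
(* [T * B] is the left-hand side of [smallT], so [T < d / 4 / B] is the condition needed. *)
pose B := M * (K * (1 + Lu * (l%:R * E))).
have B0 : 0 < B by rewrite !(mulr_gt0, addr_gt0).
pose Tstar := Num.min (Num.min (Num.min TL Tu) (Num.min Tc 1))
  (Num.min (Num.min (2^-1 / K) (1 / (l%:R * E))) (d / 4 / B)).
exists Tstar; split.
  have dB0 : 0 < d / 4 / B by rewrite divr_gt0// divr_gt0.
  have lE0 : 0 < 1 / (l%:R * E) by rewrite divr_gt0// mulr_gt0.
  have K20 : 0 < 2^-1 / K by rewrite divr_gt0.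
  by rewrite /Tstar !lt_min TL0 Tu0 Tc0 ltr01 K20 lE0 dB0.
move=> T /andP[T0]; rewrite /Tstar !lt_min => /andP[/andP[/andP[TTL TTu] /andP[TTc T1]]].
move=> /andP[/andP[TK TE] TB].
have [hL [hL0 lyaph]] := lyapT T (introT andP (conj T0 TTL)).
have [hu [hu0 uh]] := ulip T (introT andP (conj T0 TTu)).
have [hc [hc0 ch]] := cons T (introT andP (conj T0 TTc)).
(* Target for [rho h], reached for small [h] by continuity of [rho] at [0]; it gives both [eps1] and
   [smallh]. *)
pose e := Num.min 1 (d / 4 / M).
have e0 : 0 < e by rewrite lt_min ltr01 divr_gt0// divr_gt0.
have [hr hr0 rhoh] := classK_continuous rhoK.1 (lexx 0) e0.
exists (Num.min (Num.min hL hu) (Num.min hc hr)); split.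
  rewrite !lt_min hr0 !ge_min.
  by case/andP: hL0 => -> ->; case/andP: hu0 => -> _; case/andP: hc0 => -> _.
move=> w x0 h wD x0D /andP[h0]; rewrite !lt_min => /andP[/andP[hhL hhu] /andP[hhc hhr]].
have [V [_ V0 HV V_lip]] := lyaph h (introT andP (conj h0 hhL)).
have w_lt t : nonneg_reals t -> enorm (w t) < Dw.
  by move=> t0; apply: supnorm_ltP t0; case: wD.
have w_le t : 0 <= t -> enorm (w t) <= Dw.
  by move=> t0; apply/ltW/w_lt; rewrite /nonneg_reals/= in_itv/= t0.
pose energy k := \int[leb]_(s in sampling_interval T k) ghat (enorm (w s)).
pose z0 : R -> 'rV[R]_p := fun=> 0.
have z0D : Linfty_lt Dw z0.
  split; first by move=> i; exact: measurable_cst.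
  apply: (@le_lt_trans _ _ 0%E); last by rewrite lte_fin.
  by apply: supnorm_leP => t _; rewrite enorm0.
have vD v : v = w \/ v = z0 -> Lmeasurable v /\
    forall k t, sampling_interval T k t -> enorm (v t) <= rad.
  move=> vwz; have rDw : Dw <= rad by rewrite /rad lerDr ltW// addr_gt0.
  case: vwz => ->; split; [by case: wD| |by case: z0D|].
    by move=> k t /(sampling_interval_ge0 T0)/w_lt/ltW h1; exact: le_trans rDw.
  by move=> k t _; rewrite enorm0 ltW.
have D3rad : D + 3 <= rad by rewrite /rad -[leRHS]addrA lerDl addr_ge0// ltW.
have Urad : U <= rad by rewrite /rad -[leRHS]addrA addrCA lerDl addr_ge0// ltW.
have rho_le : rho h <= e.
  have := rhoh h (ltW h0); rewrite subr0 gtr0_norm// => /(_ hhr).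
  rewrite (classK0 rhoK.1) subr0 => h1; exact: le_trans (ler_norm _) (ltW h1).
have eps1 : rho h <= 1 by rewrite (le_trans rho_le)// ge_min lexx.
have smallh : M * rho h <= d / 4.
  rewrite mulrC -ler_pdivlMr// (le_trans rho_le)// ge_min lexx orbT//.
have TE1 : l%:R * (T * E) <= 1.
  by move: TE; rewrite ltr_pdivlMr ?mulr_gt0// mulrCA => /ltW.
have smallT : M * (K * (T + Lu * (l%:R * (T * E)))) <= d / 4.
  move: TB; rewrite ltr_pdivlMr// => /ltW; apply: le_trans; rewrite /B.
  by rewrite le_eqVlt; apply/orP; left; apply/eqP; ring.
have TK2 : T * K <= 2^-1 by move: TK; rewrite ltr_pdivlMr// => /ltW.
have exact_ex v k x u : v = w \/ v = z0 -> enorm x <= D + 3 -> enorm u <= U ->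
    exists y, exact_model f T x u (wseg v T k) y.
  move=> /vD[mv vr] xD uU.
  have [H _ _] := step T k v x T0 TK2 mv (vr k) (le_trans xD D3rad).
  exact: H (le_trans uU Urad).
have exact_move v k x u y : v = w \/ v = z0 -> enorm x <= D + 3 -> enorm u <= U ->
    exact_model f T x u (wseg v T k) y -> enorm (y - x) <= K * T.
  move=> /vD[mv vr] xD uU.
  have [_ H _] := step T k v x T0 TK2 mv (vr k) (le_trans xD D3rad).
  exact: H (le_trans uU Urad).
have exact_lip k x u1 u2 y1 y2 : enorm x <= D + 3 -> enorm u1 <= U -> enorm u2 <= U ->
    exact_model f T x u1 (wseg w T k) y1 -> exact_model f T x u2 (wseg w T k) y2 ->
    enorm (y1 - y2) <= K * T * (T + enorm (u1 - u2)).
  have [mv vr] := vD w (or_introl erefl) => xD u1U u2U.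
  have [_ _ H] := step T k w x T0 TK2 mv (vr k) (le_trans xD D3rad).
  by apply: H; exact: le_trans Urad.
have consist v k x u y : v = w \/ v = z0 -> enorm x <= D + 3 -> enorm u <= U ->
    exact_model f T x u (wseg v T k) y ->
    enorm (y - Fa T h x u (wseg v T k)) <= T * rho h.
  move=> vwz xD uU; have [mv vr] := vD v vwz.
  apply: ch; [|exact: le_trans D3rad|exact: le_trans Urad| |by rewrite h0].
    split => //; case: vwz => ->; [case: wD|case: z0D] => _ /lt_trans; apply.
      exact: ltry.
    exact: ltry.
  by apply: supnorm_leP => t; exact: vr.
have uc_lip x1 x2 : enorm x1 <= D + 3 -> enorm x2 <= D + 3 ->
    enorm (uc T h x2 - uc T h x1) <= Lu * enorm (x2 - x1).
  move=> h1 h2; apply: uh; first by rewrite h0.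
  by rewrite ge_max h1.
have trunc k : Linfty_lt Dw (truncation w T k) /\ Lgamma_lt ghat (g + 1) (truncation w T k).
  split; first exact: Linfty_lt_truncation.
  apply: Lgamma_lt_truncation wD _ => //.
  rewrite (@le_lt_trans _ _ g) ?ltrDl//.
  by rewrite -[leRHS]mul1r ler_wpM2r// ltW.
(* The bounds on [V] are stated together with a disturbance; the truncation to period [0] is an
   admissible one. *)
have V_bounds x : enorm x <= D + 3 -> alow (enorm x) <= V x <= aup (enorm x).
  by move=> xD; have [] := HV x _ xD (trunc 0%N).1 (trunc 0%N).2.
have V_decr k x : enorm x <= D + 3 ->
    V (Fa T h x (uc T h x) (wseg w T k)) - V x <=
    T * (- alpha (enorm x) + T^-1 * energy k + d / 2).
  move=> xD; have [_ /(_ k)] := HV x _ xD (trunc k).1 (trunc k).2.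
  rewrite /single_rate_approx wseg_truncation => /le_trans; apply.
  rewrite ler_pM2l// lerD2r lerD2l ler_pM2l ?invr_gt0//.
  rewrite le_eqVlt; apply/orP; left; apply/eqP; apply: eq_Rintegral => t /set_mem St.
  by rewrite /truncation /patch mem_set.
have V_lip' x1 x2 : enorm x1 <= D + 3 -> enorm x2 <= D + 3 ->
    `|V x1 - V x2| <= M * enorm (x1 - x2).
  by move=> h1 h2; apply: V_lip; rewrite ge_max h1.
have energy_le k : energy k <= T * g.
  exact: (Rintegral_sampling_le k ghatK T0 wD.1 w_le).
have alpha_ge0 s : 0 <= s -> 0 <= alpha s by apply: classK_ge0; case: alphaK.
have aup_mono s t : 0 <= s -> s <= t -> aup s <= aup t.
  by apply: classK_le; case: aupK.
have alow_D s : D <= s -> c < alow s.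
  by move=> Ds; apply: alow_D'; apply: le_trans Ds; rewrite lerDl ltW.
have c_r : aup r + g + d <= c by rewrite !lerD2r lerDr.
have x0Dl : enorm x0 <= D by rewrite (le_trans x0D)// lerDr ltW.
have Vx0 : V x0 <= aup (enorm x0).
  have /V_bounds/andP[_] // : enorm x0 <= D + 3.
  by rewrite (le_trans x0Dl)// lerDl.
have Vx0c : V x0 <= c.
  rewrite (le_trans Vx0)// (le_trans (aup_mono _ _ (enorm_ge0 x0) x0D))//.
  by rewrite /c -!addrA lerDl addr_ge0// addr_ge0// ltW.
split.
  apply: (@dual_rate_exact_exists R n m p f l Fa uc T h w V alow aup alpha energy
    D U r c d g K E Lu M (rho h)) => //; first exact: ltW.
  exact: uc0.
move=> x xx0 sol k.
have xc : V (x 0%N) <= c by rewrite xx0.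
have xD : enorm (x 0%N) <= D by rewrite xx0.
have := @loop_dissipation R n m p f l Fa uc T h w V alow aup alpha energy
    D U r c d g K E Lu M (rho h) erefl l_ge1 T0 (ltW T1) K0 TK2 TE1 D0 M0 Lu0 eps1 smallT
    smallh d0 g0 erefl alpha_ge0 aup_mono alpha_r alow_D c_r energy_le exact_ex
    exact_move exact_lip consist uc_lip (uc0 T h T0 h0) V_bounds V_decr V_lip'
    x xc xD sol k.
have -> : \sum_(i < k) energy i = \int[leb]_(s in `[0, k%:R * T]) ghat (enorm (w s)).
  elim: k => [|k ih].
    by rewrite big_ord0 mul0r set_itv1 Rintegral_leb_set1.
  rewrite big_ord_recr /= ih; apply/esym/Rintegral_leb_chasles.
  - by rewrite mulr_ge0// ltW.
  - by rewrite ler_pM2r// ler_nat.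
  - exact: (integrable_classK_enorm _ ghatK (lexx 0) wD.1 w_le).
move=> /le_trans; apply.
(* The term [V (x k)] is dropped since [V] is nonnegative. *)
by rewrite !lerD2r xx0 lerBlDr (le_trans Vx0)// lerDl.
Qed.
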